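(* Let $p,q,r,s$ be distinct primes such that $p \equiv q \equiv 3 \pmod 4$ and $r \equiv s \equiv 1 \pmod 4$. Then $\mathbb{Q}(\sqrt{p}, \sqrt{qrs})$ is a Pólya field in the following cases. (i) $\left(\frac{2}{r}\right) = \left(\frac{2}{s}\right) = -1$ and at least one of the following conditions holds: C1: $\left(\frac{q}{r}\right) = \left(\frac{q}{s}\right) = \left(\frac{rs}{p}\right) = -1$. C2: $\left(\frac{rs}{q}\right) = \left(\frac{r}{p}\right) = \left(\frac{s}{p}\right) = -1$. (ii) $\left(\frac{2}{r}\right) = 1$, $\left(\frac{2}{s}\right) = -1$, and at least one of the following conditions holds: C3: $\left(\frac{r}{s}\right) = \left(\frac{q}{s}\right) = \left(\frac{r}{p}\right) = -1$ and $\left(\frac{r}{q}\right) = 1$. C4: $\left(\frac{r}{q}\right) = \left(\frac{r}{s}\right) = \left(\frac{r}{p}\right) = -1$ and $\left(\frac{s}{p}\right) = 1$. C5: $\left(\frac{r}{q}\right) = \left(\frac{r}{p}\right) = \left(\frac{pq}{s}\right) = -1$ and $\left(\frac{r}{s}\right) = 1$.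
   Context: Here $\left(\frac{a}{\ell}\right)$ is the Legendre symbol for an odd prime $\ell$. For a number field $K$ with ring of integers $\mathcal{O}_K$, a prime number $\ell$ and an integer $f\ge 1$, the Ostrowski ideal $\Pi_{\ell^f}(K)$ is the product of all maximal ideals $\mathfrak{m}$ of $\mathcal{O}_K$ with norm $N_{K/\mathbb{Q}}(\mathfrak{m}) = \ell^f$ (equal to $\mathcal{O}_K$ if there are none). The Pólya group $Po(K)$ is the subgroup of the ideal class group of $K$ generated by the classes of all Ostrowski ideals of $K$. $K$ is a Pólya field if all its Ostrowski ideals are principal, equivalently if $Po(K)$ is trivial. *)

(* Defs.v *)
From HB Require Import structures.
From mathcomp Require Import all_boot all_order all_algebra all_field.
From mathcomp Require Import finmap.
From mathcomp Require Import boolp classical_sets functions cardinality fsbigop.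

Set Implicit Arguments.
Unset Strict Implicit.
Unset Printing Implicit Defensive.

Import Order.TTheory GRing.Theory Num.Theory.

Local Open Scope classical_set_scope.
Local Open Scope ring_scope.

(* Junk value when l is not prime: 'F_l is then the field of order the least  *)
(* prime factor of l.                                                         *)
Definition legendre (a : int) (l : nat) : int :=
  if a%:~R == 0 :> 'F_l then 0
  else if [exists x : 'F_l, x ^+ 2 == a%:~R] then 1 else -1.

(* The number field generated by the algebraic numbers in s. It comes, by     *)
(* tagged (num_field_exists s), with an embedding into algC and a sequence of *)
(* elements that generates it over rat and is mapped to s.                    *)
Definition Qadjoin (s : seq algC) : fieldExtType rat := tag (num_field_exists s).

Section RingOfIntegers.
Variable K : fieldExtType rat.

Definition algint : {pred K} :=
  fun x => `[< integralOver (intr : int -> K) x >].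

Lemma algintP (x : K) : reflect (integralOver (intr : int -> K) x) (x \in algint).
Proof. exact: asboolP. Qed.

Lemma algint_subring : subring_closed algint.
Proof.
split; first exact/algintP/integral1.
- by move=> x y /algintP Zx /algintP Zy; apply/algintP/integral_sub.
- by move=> x y /algintP Zx /algintP Zy; apply/algintP/integral_mul.
Qed.

HB.instance Definition _ := GRing.isSubringClosed.Build K algint algint_subring.

Record ring_of_integers :=
  RingOfIntegers { roi_val :> K; roi_valP : roi_val \in algint }.

HB.instance Definition _ := [isSub for roi_val].
HB.instance Definition _ := [Choice of ring_of_integers by <:].
HB.instance Definition _ := [SubChoice_isSubComNzRing of ring_of_integers by <:].

End RingOfIntegers.

Section Ideals.
Variable R : comNzRingType.
Implicit Types I J M : set R.

Definition is_ideal I :=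
  [/\ I 0, (forall x y, I x -> I y -> I (x + y))
    & (forall a x, I x -> I (a * x))].

Definition is_maximal_ideal M :=
  [/\ is_ideal M, M <> setT
    & forall J, is_ideal J -> M `<=` J -> J = M \/ J = setT].

Definition is_principal I := exists a : R, I = [set a * x | x in setT].

Definition ideal_mul I J : set R :=
  [set x | exists n (a b : 'I_n -> R),
    [/\ forall i, I (a i), forall i, J (b i) & x = \sum_i a i * b i]].

Definition cosets I : set (set R) :=
  [set [set x + y | y in I] | x in setT].

(* The cardinality of R / I, with value 0 if R / I is infinite. *)
Definition ideal_norm I : nat := #|` fset_set (cosets I) |%fset.

End Ideals.

Section Polya.
Variable K : fieldExtType rat.
Local Notation O := (ring_of_integers K).

(* A product over a set is the neutral element, here the unit ideal setT, if  *)
(* the set is empty or infinite; only finitely many ideals have norm l ^ f.   *)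
Definition ostrowski_ideal (l f : nat) : set O :=
  \big[@ideal_mul O/setT]_(M \in [set M : set O |
    is_maximal_ideal M /\ ideal_norm M = (l ^ f)%N]) M.

Definition polya_field :=
  forall l f : nat, prime l -> (0 < f)%N -> is_principal (ostrowski_ideal l f).

End Polya.

(* Main.v *)
Require Import Defs.
From HB Require Import structures.
From mathcomp Require Import all_boot all_order all_algebra all_fingroup.
From mathcomp Require Import all_solvable all_field.
From mathcomp Require Import finmap.
From mathcomp Require Import boolp classical_sets functions cardinality fsbigop.
From mathcomp Require Import zify ring.

(** Let d = q r s and K = Q(sqrt p, sqrt d), with Galois group
    {1, sg, tau, sg tau}.

    Fix a prime l and a maximal ideal M of norm a power of l. Let J be the
    intersection of the conjugates of M: it is stable under the Galois group
    and meets the integers in l Z. As soon as J is generated by an element a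
    with a^2 / l integral, every maximal ideal above l is a conjugate of M
    (one that is not is comaximal with J, yet contains a), so that all of them
    have the same norm and their product is J = (a). This is
    [prod_maximal_orbit] and [ostrowski_principal]; it leaves only the task of
    finding, for each l, an element a that divides all the elements of every
    such J. If l is odd and divides neither p nor d, then a = l will do
    ([unramified_divides]). If l is odd and l = a^2 times a unit, then a will
    do ([ramified_divides]). If l = 2, then an element of Q(sqrt p) of norm 2
    or -2 will do ([two_divides]).

    So K is a Polya field if Q(sqrt p) has such an element and if each of
    p, q, r, s is a unit times a square in K. Clearly p and d are. The rest comes
    from the equation x^2 - D y^2 = 1: its smallest solution gives, by
    splitting (x - 1) (x + 1), a relation u a^2 = v b^2 + c with u v = D and
    c = 1 or 2, which is not one of the trivial ones ([pell_descent]), and then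
    u c is a unit times a square in Q(sqrt D) ([descent_unit_square]). For
    D = p this gives the element of norm 2 or -2 and the class of 2. For
    D = d and D = p d it gives two classes u, in which the factors 2 and p can
    now be ignored; they belong to the group generated by q, r and s modulo
    squares and modulo d, which has order 4. It remains to
    see that these two classes are independent. The congruences of the two
    relations modulo r and modulo s restrict the possible u; after all symbols
    have been moved to the moduli r and s by [quadratic_reciprocity], a finite
    check ([independent_classes]) shows that each of the five sets of
    conditions leaves only independent pairs. *)

Set Implicit Arguments.
Unset Strict Implicit.
Unset Printing Implicit Defensive.

Import Order.TTheory GRing.Theory Num.Theory.
Local Open Scope ring_scope.

(** * Quadratic residues and the reciprocity law *)

Definition qchar (F : finFieldType) (x : F) : int :=
  if x == 0 then 0 else if [exists y : F, y ^+ 2 == x] then 1 else -1.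

Lemma legendreE a l : legendre a l = qchar (a%:~R : 'F_l).
Proof. by []. Qed.

Lemma finField_gt1 (F : finFieldType) : (1 < #|F|)%N.
Proof. exact: finRing_gt1. Qed.

Lemma finField_prim_root (F : finFieldType) :
  exists z : F, (#|F|.-1).-primitive_root z.
Proof.
have F1 := finField_gt1 F.
suff /hasP[z _ zP] : has (#|F|.-1).-primitive_root [seq x <- enum F | x != 0].
  by exists z.
apply: has_prim_root; first by lia.
- apply/allP=> x; rewrite mem_filter => /andP[x0 _]; rewrite unity_rootE.
  apply/eqP/(mulfI x0); rewrite -exprS prednK ?mulr1 ?expf_card //; lia.
- by rewrite filter_uniq // enum_uniq.
rewrite size_filter -(leq_add2r (count (pred1 0) (enum F))) addnC.
rewrite [X in (_ <= X)%N]addnC count_predC -cardE.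
rewrite count_uniq_mem ?enum_uniq // mem_enum inE add1n prednK //; lia.
Qed.

Section QuadraticCharacter.
Variable F : finFieldType.
Hypothesis F2 : odd #|F|.
Implicit Types x y : F.

Lemma half_card : (((#|F|.-1)./2).*2 = #|F|.-1)%N.
Proof.
by rewrite even_halfK // -[odd _]negbK -oddS prednK ?F2 // ltnW // finField_gt1.
Qed.

Lemma neg1_neq1 : (-1 : F) != 1.
Proof.
apply/eqP=> e; have [z zP] := finField_prim_root F.
have F1 := finField_gt1 F; set n := #|F|.-1 in zP.
have n2 : (n./2.*2 = n)%N := half_card.
have : (z ^+ n./2) ^+ 2 == 1 by rewrite -exprM muln2 n2 prim_expr_order.
have n0 : (0 < n)%N by rewrite /n; lia.
rewrite sqrf_eq1 e orbb -(prim_order_dvd zP) => dv.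
have := dvdn_leq _ dv; clearbody n; lia.
Qed.

(** All the properties of squares used here follow from this one: with respect
    to a generator of the multiplicative group, being a square is the parity of
    the exponent. *)
Lemma qchar_prim (z : F) i : (#|F|.-1).-primitive_root z ->
  qchar (z ^+ i) = (-1) ^+ i.
Proof.
move=> zP; have F1 := finField_gt1 F.
have z0 : z != 0.
  apply/eqP=> z0; have := prim_expr_order zP.
  by rewrite z0 expr0n eqn0Ngt (prim_order_gt0 zP) => /esym/eqP; rewrite oner_eq0.
rewrite /qchar expf_eq0 (negPf z0) andbF -signr_odd.
case: existsP => [[y /eqP yz] | nsq]; last first.
  case: (boolP (odd i)) => //= ev; case: nsq; exists (z ^+ i./2).
  by rewrite -exprM muln2 even_halfK.
have y0 : y != 0.
  apply/eqP=> y0; move: yz; rewrite y0 expr0n => /esym/eqP.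
  by rewrite expf_eq0 (negPf z0) andbF.
have [|j yE] := prim_rootP zP (x := y).
  apply/(mulfI y0); rewrite -exprS prednK ?mulr1 ?expf_card //; lia.
move: yz => /eqP; rewrite yE -exprM (eq_prim_root_expr zP) => /eqP ji.
have : odd i = odd (j * 2) by rewrite -(odd_mod i (d := #|F|.-1)) -?ji ?odd_mod //; lia.
by rewrite oddM andbF => ->.
Qed.

Lemma qchar0 : qchar (0 : F) = 0.
Proof. by rewrite /qchar eqxx. Qed.

Lemma prim_or0 (z : F) x : (#|F|.-1).-primitive_root z -> x = 0 \/ exists i, x = z ^+ i.
Proof.
move=> zP; have [->|x0] := eqVneq x 0; [by left|right].
have F1 := finField_gt1 F.
have [|j yE] := prim_rootP zP (x := x); last by exists j.
apply/(mulfI x0); rewrite -exprS prednK ?mulr1 ?expf_card //; lia.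
Qed.

Lemma qcharM x y : qchar (x * y) = qchar x * qchar y.
Proof.
have [z zP] := finField_prim_root F.
case: (prim_or0 x zP) => [->|[i ->]]; first by rewrite mul0r qchar0 mul0r.
case: (prim_or0 y zP) => [->|[j ->]]; first by rewrite mulr0 qchar0 mulr0.
by rewrite -exprD !(qchar_prim _ zP) exprD.
Qed.

Lemma qchar_euler x : (qchar x)%:~R = x ^+ (#|F|.-1)./2.
Proof.
have F1 := finField_gt1 F; have [z zP] := finField_prim_root F.
case: (prim_or0 x zP) => [->|[i ->]].
  by rewrite qchar0 expr0n; case: eqP => //; lia.
rewrite (qchar_prim _ zP) -exprM mulnC exprM rmorphXn rmorphN1; congr (_ ^+ _).
apply/esym/eqP; have : (z ^+ (#|F|.-1)./2) ^+ 2 == 1.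
  by rewrite -exprM muln2 half_card prim_expr_order.
rewrite sqrf_eq1 => /orP[|//]; have h := half_card.
rewrite -(prim_order_dvd zP) => dv; have := dvdn_leq _ dv; lia.
Qed.

Lemma qcharX2 x : x != 0 -> qchar (x ^+ 2) = 1.
Proof.
move=> x0; rewrite /qchar sqrf_eq0 (negPf x0).
by case: existsP => // -[]; exists x.
Qed.

Lemma qchar_values x : x != 0 -> qchar x = 1 \/ qchar x = -1.
Proof. by rewrite /qchar => /negPf ->; case: ifP; auto. Qed.

(** Multiplication by a nonsquare permutes F and changes the sign of every
    term. *)
Lemma sum_qchar : \sum_(x : F) qchar x = 0.
Proof.
have [z zP] := finField_prim_root F; have F1 := finField_gt1 F.
have z0 : z != 0.
  by apply/eqP=> z0; have := qchar_prim 1 zP; rewrite !expr1 z0 qchar0.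
have : \sum_(x : F) qchar x = - \sum_(x : F) qchar x.
  rewrite [LHS](reindex_inj (mulfI z0)) -sumrN; apply: eq_bigr => x _.
  by rewrite qcharM -{1}[z]expr1 (qchar_prim _ zP) expr1 mulN1r.
lia.
Qed.

End QuadraticCharacter.

Lemma qcharN1 r : prime r -> r = 1 %[mod 4] -> qchar (-1 : 'F_r) = 1.
Proof.
move=> r_prime r_mod4; have oddr : odd #|'F_r| by rewrite card_Fp //; lia.
case: (@qchar_values _ (-1 : 'F_r)) => //; first by rewrite oppr_eq0 oner_eq0.
move=> e; have := qchar_euler oddr (-1); rewrite e card_Fp //.
rewrite -signr_odd (_ : odd _ = false) ?expr0; last by lia.
by move/eqP; rewrite (negPf (neg1_neq1 oddr)).
Qed.

Section GaussSum.
Variables (r : nat) (L : finFieldType) (w : L).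
Hypotheses (r_prime : prime r) (r_mod4 : r = 1 %[mod 4]) (wP : r.-primitive_root w).

Let oddr : odd #|'F_r|.
Proof. by rewrite card_Fp //; clear wP; lia. Qed.

Let psi (a : 'F_r) : L := w ^+ a.

Let psiD a b : psi (a + b) = psi a * psi b.
Proof.
rewrite /psi -exprD -(prim_expr_mod wP (a + b)%N); congr (_ ^+ _).
by congr (modn _ _); apply: Fp_cast.
Qed.

Let psi0 : psi 0 = 1.
Proof. by []. Qed.

Let psiMn a n : psi (a *+ n) = psi a ^+ n.
Proof. by elim: n => [|n IH]; rewrite ?psi0 // mulrS psiD IH exprS. Qed.

Let sum_psi (c : 'F_r) : \sum_a psi (a * c) = if c == 0 then r%:R else 0.
Proof.
have [->|c0] := eqVneq c 0.
  rewrite (eq_bigr (fun=> 1)) => [|a _]; last by rewrite mulr0.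
  by rewrite sumr_const card_Fp.
have -> : \sum_a psi (a * c) = \sum_a psi a.
  by rewrite [RHS](reindex_inj (mulIf c0)).
set S := \sum_a _.
have psi1 : psi 1 != 1.
  rewrite /psi -(prim_order_dvd wP) (_ : nat_of_ord 1 = 1%N) ?dvdn1 //.
  by apply: contraTneq r_prime => ->.
have : (psi 1 - 1) * S = 0.
  rewrite mulrBl mul1r mulr_sumr (eq_bigr (fun a => psi (1 + a))) => [|a _].
    by rewrite /S [X in _ - X](reindex_inj (addrI 1)) subrr.
  by rewrite psiD.
by move/eqP; rewrite mulf_eq0 subr_eq0 (negPf psi1) => /eqP.
Qed.

(** The quadratic Gauss sum, formed with a primitive root of unity w that lives
    in a finite field rather than among the complex numbers. *)
Definition gauss_sum : L := \sum_(a : 'F_r) (qchar a)%:~R * w ^+ a.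

(** Writing the second index as a c, the double sum becomes the sum over c of
    [qchar c] times the sum over nonzero a of w^(a (c + 1)); the inner sum is
    r - 1 for c = -1 and -1 otherwise. The sign is plus because -1 is a square
    modulo r. *)
Lemma gauss_sumX2 : gauss_sum ^+ 2 = r%:R.
Proof.
have termE (a : 'F_r) : (qchar a)%:~R * psi a * gauss_sum
    = \sum_c (qchar c)%:~R * (psi (a * (c + 1)) - (a == 0)%:R).
  have [->|a0] := eqVneq a 0.
    rewrite qchar0 !mul0r big1 // => c _.
    by rewrite mul0r psi0 subrr mulr0.
  rewrite /gauss_sum (reindex_inj (mulfI a0)) mulr_sumr; apply: eq_bigr => c _.
  rewrite -/(psi _) qcharM // intrM subr0 mulrDr mulr1 psiD.
  have -> : (qchar a)%:~R * psi a * ((qchar a)%:~R * (qchar c)%:~R * psi (a * c))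
      = (qchar a * qchar a)%:~R * ((qchar c)%:~R * (psi (a * c) * psi a)) :> L.
    rewrite intrM; ring.
  by rewrite -qcharM // -expr2 qcharX2 // mul1r.
rewrite expr2 {1}/gauss_sum mulr_suml (eq_bigr _ (fun a _ => termE a)).
rewrite exchange_big /=.
transitivity (\sum_(c : 'F_r) ((qchar c)%:~R * (if c == -1 then r%:R else 0)
   - (qchar c)%:~R) : L).
  apply: eq_bigr => c _; rewrite -mulr_sumr big_split /= sum_psi addr_eq0.
  rewrite sumrN (bigD1 0) //= ?eqxx big1 ?addr0 ?mulrBr ?mulr1 // => a /negPf ->.
  by [].
rewrite sumrB (bigD1 (-1)) //= ?eqxx (qcharN1 r_prime r_mod4) mul1r.
rewrite big1 ?addr0; last first.
  by move=> c /negPf ->; rewrite mulr0.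
by rewrite -(rmorph_sum intr) /= sum_qchar // subr0.
Qed.

(** In characteristic l, raising to the power l is additive, fixes the symbols
    and turns w^a into w^(l a). *)
Lemma gauss_sum_Frobenius l : l \in [pchar L] -> prime l -> l != r ->
  gauss_sum ^+ l = (qchar (l%:R : 'F_r))%:~R * gauss_sum.
Proof.
move=> lL l_prime lr; have l0 : (l%:R : 'F_r) != 0.
  by rewrite -(dvdn_pcharf (pchar_Fp r_prime)) dvdn_prime2 // eq_sym.
rewrite -(pFrobenius_autE lL) rmorph_sum /=.
rewrite [in RHS]/gauss_sum [in RHS](reindex_inj (mulfI l0)) mulr_sumr.
apply: eq_bigr => a _; rewrite rmorphM rmorph_int /= pFrobenius_autE.
have pl : psi (l%:R * a) = psi a ^+ l by rewrite mulr_natl psiMn.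
rewrite -/(psi a) -/(psi (l%:R * a)) pl mulrA -intrM qcharM // mulrA.
by rewrite -[qchar _ * qchar _]qcharM // -expr2 qcharX2 // mul1r.
Qed.

End GaussSum.

(** The Gauss sum G for r exists in the field with l^(r - 1) elements, since r
    divides l^(r - 1) - 1. There G^(l - 1) is legendre l r by the action of
    Frobenius, and legendre r l by Euler's criterion because G^2 = r. *)
Lemma quadratic_reciprocity r l : prime r -> prime l -> odd l -> r != l ->
  r = 1 %[mod 4] -> legendre r l = legendre l r.
Proof.
move=> r_prime l_prime oddl rl r_mod4.
have r1 := prime_gt1 r_prime.
have [|L lL cardL] := @pPrimePowerField l r.-1 l_prime; first by lia.
have [z zP] := finField_prim_root L.
have : (r %| #|L|.-1)%N.
  rewrite cardL -subn1 -eqn_mod_dvd ?expn_gt0 ?prime_gt0 //.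
  rewrite -(totient_prime r_prime) Euler_exp_totient //.
  by rewrite coprime_sym prime_coprime // dvdn_prime2.
move/(dvdn_prim_root zP); set w := z ^+ _ => wP.
have oddL : odd #|L| by rewrite cardL oddX oddl orbT.
have oddFl : odd #|'F_l| by rewrite card_Fp.
have rL : (r%:R : L) != 0 by rewrite -(dvdn_pcharf lL) dvdn_prime2 // eq_sym.
have rl0 : (r%:R : 'F_l) != 0.
  by rewrite -(dvdn_pcharf (pchar_Fp l_prime)) dvdn_prime2 // eq_sym.
have lr0 : (l%:R : 'F_r) != 0.
  by rewrite -(dvdn_pcharf (pchar_Fp r_prime)) dvdn_prime2 // eq_sym.
have G2 := gauss_sumX2 r_prime r_mod4 wP.
have G0 : gauss_sum r w != 0 by rewrite -sqrf_eq0 G2.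
have eulL : (r%:R : L) ^+ (l.-1)./2 = (qchar (l%:R : 'F_r))%:~R.
  rewrite -G2 -exprM mulnC muln2 even_halfK; last by case: (l) oddl.
  apply/(mulIf G0); rewrite -exprSr prednK ?prime_gt0 //.
  by rewrite gauss_sum_Frobenius // eq_sym.
have : (l %| (r%:Z ^+ (l.-1)./2 - qchar (r%:R : 'F_l)))%Z.
  rewrite (dvdz_pcharf (pchar_Fp l_prime)) rmorphB rmorphXn /= qchar_euler //.
  by rewrite card_Fp // subrr.
rewrite (dvdz_pcharf lL) rmorphB rmorphXn /= eulL subr_eq0 !legendreE /=.
have := neg1_neq1 oddL.
case: (qchar_values rl0) (qchar_values lr0) => -> [] -> // /negPf n1 /eqP //.
  by move/eqP; rewrite n1.
by move/eqP; rewrite eq_sym n1.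
Qed.

(** The symbol as a bit, so that multiplicativity reads as addition modulo 2. *)
Definition nonresidue (l a : nat) : bool := legendre a%:Z l == -1.

Section Nonresidue.
Variable l : nat.
Hypotheses (l_prime : prime l) (l_odd : odd l).

Lemma legendre_nat (a : nat) : legendre a%:Z l = qchar (a%:R : 'F_l).
Proof. by []. Qed.

Lemma Fp_nat_eq0 (a : nat) : (a%:R == 0 :> 'F_l) = (l %| a)%N.
Proof. by rewrite (dvdn_pcharf (pchar_Fp l_prime)). Qed.

Lemma legendre_nonresidue a : ~~ (l %| a)%N -> legendre a%:Z l = (-1) ^+ nonresidue l a.
Proof.
by rewrite -Fp_nat_eq0 /nonresidue !legendre_nat => /qchar_values[] ->.
Qed.

Let oddF : odd #|'F_l|. Proof. by rewrite card_Fp. Qed.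

Lemma nonresidueM a b : ~~ (l %| a)%N -> ~~ (l %| b)%N ->
  nonresidue l (a * b) = nonresidue l a (+) nonresidue l b.
Proof.
move=> la lb; have lab : ~~ (l %| a * b)%N by rewrite Euclid_dvdM // negb_or la.
have := qcharM oddF (a%:R : 'F_l) b%:R; rewrite -natrM -!legendre_nat.
rewrite !legendre_nonresidue // -signr_addb.
by case: (nonresidue l (a * b)); case: (_ (+) _).
Qed.

Lemma nonresidueX a (b : bool) : nonresidue l (a ^ b) = nonresidue l a && b.
Proof.
case: b; rewrite ?andbT ?expn1 // andbF expn0 /nonresidue legendre_nat.
by rewrite -[_%:R](expr1n _ 2) qcharX2 ?oner_eq0.
Qed.

Lemma nonresidue_eqn_l u v a b c : (l %| v)%N -> ~~ (l %| c)%N ->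
  (u * a ^ 2 = v * b ^ 2 + c)%N -> nonresidue l u = nonresidue l c.
Proof.
rewrite -!Fp_nat_eq0 /nonresidue !legendre_nat => /eqP v0 c0 uv.
have e : u%:R * a%:R ^+ 2 = c%:R :> 'F_l.
  by rewrite -natrX -natrM uv natrD natrM v0 mul0r add0r.
have a0 : a%:R != 0 :> 'F_l.
  by apply: contra_neq c0 => a0; rewrite -e a0 expr0n mulr0.
by rewrite -e (qcharM oddF u%:R) qcharX2 // mulr1.
Qed.

Lemma nonresidue_eqn_r u v a b c : (l = 1 %[mod 4])%N -> (l %| u)%N -> ~~ (l %| c)%N ->
  (u * a ^ 2 = v * b ^ 2 + c)%N -> nonresidue l v = nonresidue l c.
Proof.
move=> l4; rewrite -!Fp_nat_eq0 /nonresidue !legendre_nat => /eqP u0 c0 uv.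
have e : v%:R * b%:R ^+ 2 = -1 * c%:R :> 'F_l.
  apply/eqP; rewrite mulN1r -addr_eq0 -natrX -natrM -natrD -uv natrM u0.
  by rewrite mul0r.
have b0 : b%:R != 0 :> 'F_l.
  apply: contra_neq c0 => b0; apply/eqP; rewrite -oppr_eq0 -mulN1r -e b0.
  by rewrite expr0n mulr0.
have := congr1 (@qchar _) e; rewrite (qcharM oddF v%:R) (qcharM oddF (-1)).
by rewrite (qcharN1 l_prime l4) mul1r qcharX2 // mulr1 => ->.
Qed.

(** Modulo l one of the two terms vanishes. It does not matter which one, as -1
    is a square modulo l. *)
Lemma nonresidue_descent (e : bool) x y a b c : (l = 1 %[mod 4])%N -> ~~ (l %| c)%N ->
  (l ^ e * x * a ^ 2 = l ^ (~~ e) * y * b ^ 2 + c)%N ->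
  nonresidue l (if e then y else x) = nonresidue l c.
Proof.
move=> l4 lc; case: e => /=; rewrite expn1 expn0 mul1n.
  by apply: nonresidue_eqn_r => //; apply: dvdn_mulr.
by apply: nonresidue_eqn_l => //; apply: dvdn_mulr.
Qed.

End Nonresidue.

Lemma nonresidue_sym r l : prime r -> prime l -> odd l -> r != l ->
  (r = 1 %[mod 4])%N ->
  nonresidue r l = nonresidue l r.
Proof. by move=> *; rewrite /nonresidue (quadratic_reciprocity (l := l) (r := r)). Qed.

(** If b^2 = -1, Euler's criterion gives 1 = (-1)^((l - 1)/2) = -1. *)
Lemma neg1_nonsquare l b : prime l -> (l = 3 %[mod 4])%N -> ~~ (l %| b ^ 2 + 1)%N.
Proof.
move=> lp l4; rewrite -Fp_nat_eq0 // natrD natrX addr_eq0; apply/eqP=> e.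
have oF : odd #|'F_l| by rewrite card_Fp //; lia.
have b0 : b%:R != 0 :> 'F_l.
  by apply/eqP=> b0; move/eqP: e; rewrite b0 expr0n eq_sym oppr_eq0 oner_eq0.
have := qchar_euler oF (-1); rewrite -e qcharX2 // e card_Fp // -signr_odd.
rewrite (_ : odd _ = true) ?expr1; last by lia.
by move=> /esym/eqP; rewrite (negPf (neg1_neq1 oF)).
Qed.

Lemma nonresidueXM l a b (x y : bool) : prime l -> odd l ->
    ~~ (l %| a)%N -> ~~ (l %| b)%N ->
  nonresidue l (a ^ x * b ^ y) = (nonresidue l a && x) (+) (nonresidue l b && y).
Proof.
move=> lp lo la lb; have ndX c (z : bool) : ~~ (l %| c)%N -> ~~ (l %| c ^ z)%N.
  by rewrite Euclid_dvdX // negb_and => ->.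
by rewrite nonresidueM ?ndX // !nonresidueX.
Qed.

(** * Pell's equation and its descent *)

Section ContinuedFraction.
Variables (d s : int).
Hypotheses (s_gt0 : 0 < s) (s_lt : s ^+ 2 < d) (d_lt : d < (s + 1) ^+ 2).

(** The pair (P, Q) stands for (P + sqrt d) / Q. As s is the integer part of
    sqrt d, the inequalities say that this number exceeds 1 and that its
    conjugate lies between -1 and 0. *)
Definition reduced (x : int * int) :=
  [&& 0 < x.1, x.1 <= s, s - x.1 < x.2, x.2 <= s + x.1
    & (x.2 %| d - x.1 ^+ 2)%Z].

Definition cf_quotient (x : int * int) : int := ((x.1 + s) %/ x.2)%Z.

Definition cf_step (x : int * int) : int * int :=
  let P := cf_quotient x * x.2 - x.1 in (P, ((d - P ^+ 2) %/ x.2)%Z).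

Lemma cf_stepP x : reduced x ->
  [/\ 0 < cf_quotient x, (cf_step x).1 = cf_quotient x * x.2 - x.1,
      x.2 * (cf_step x).2 = d - (cf_step x).1 ^+ 2, reduced (cf_step x)
    & s - x.2 < (cf_step x).1].
Proof.
case: x => P Q /and5P[/= P0 Ps Ql Qu dv] /=; set a := cf_quotient _; set y := cf_step _.
have Q0 : 0 < Q by lia.
have aE : (P + s) = a * Q + ((P + s) %% Q)%Z by exact: divz_eq.
have r0 : 0 <= ((P + s) %% Q)%Z by apply: modz_ge0; lia.
have r1 : ((P + s) %% Q)%Z < Q by apply: ltz_pmod.
move: aE r0 r1; set m := (_ %% _)%Z => aE r0 r1.
have a0 : 0 < a.
  rewrite ltNge; apply/negP=> a0; have : a * Q <= 0 by rewrite pmulr_lle0.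
  lia.
have aQ : Q <= a * Q by rewrite ler_peMl //; lia.
have y1E : y.1 = a * Q - P by [].
have dvy : (Q %| d - y.1 ^+ 2)%Z.
  rewrite y1E (_ : _ - _ = (d - P ^+ 2) + (a * (P *+ 2 - a * Q)) * Q); last by ring.
  by rewrite rpredD // dvdz_mull.
have y2E : Q * y.2 = d - y.1 ^+ 2 by rewrite mulrC divzK.
have y1l : s - Q < y.1 by rewrite y1E; lia.
have y1u : y.1 <= s by rewrite y1E; lia.
have y1p : 0 < y.1 by rewrite y1E; lia.
have y1Q : Q <= s + y.1 by rewrite y1E; lia.
split=> //; apply/and5P; split=> //; last 1 first.
- by rewrite -y2E dvdz_mull.
- move: y1u y1Q y1p y2E; case: (y) => A B /= As QA A0 QB.
  rewrite ltNge; apply/negP=> Bs.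
  have h1 : Q * B <= Q * (s - A) by rewrite ler_pM2l.
  have h2 : Q * (s - A) <= (s + A) * (s - A) by rewrite ler_wpM2r //; lia.
  have h3 : (s + A) * (s - A) = s ^+ 2 - A ^+ 2 by ring.
  by rewrite h3 in h2; lia.
- move: y1l y1p y2E; case: (y) => A B /= Al A0 QB.
  rewrite leNgt; apply/negP=> Bs.
  have h1 : Q * (s + 1 + A) <= Q * B by rewrite ler_pM2l //; lia.
  have h2 : (s + 1 - A) * (s + 1 + A) <= Q * (s + 1 + A).
    by rewrite ler_pM2r; lia.
  have h3 : (s + 1 - A) * (s + 1 + A) = (s + 1) ^+ 2 - A ^+ 2 by ring.
  by rewrite h3 in h2; lia.
Qed.

(** The step can be undone: from (A, B) one recovers Q = (d - A^2) / B, and then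
    P as the only integer in ]s - Q, s] congruent to -A modulo Q. *)
Lemma cf_step_inj x y : reduced x -> reduced y -> cf_step x = cf_step y -> x = y.
Proof.
move=> rx ry exy; have := cf_stepP rx; have := cf_stepP ry; rewrite -exy.
move: (cf_step x) (cf_quotient x) (cf_quotient y) => [A B] a b.
case: x rx {exy} => P Q /and5P[/= P0 Ps Ql Qu _].
case: y ry => P' Q' /and5P[/= P0' Ps' Ql' Qu' _].
move=> [b0 BE' QE' _ lY] [a0 AE QE rX lX].
have B0 : 0 < B by case/and5P: rX => /=; lia.
have QQ : Q = Q' by apply: (mulIf (lt0r_neq0 B0)); rewrite QE QE'.
subst Q'; suff -> : P = P' by [].
have kE : (b - a) * Q = P' - P by rewrite mulrBl; lia.
have Q0 : 0 < Q by lia.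
have [k|[k|k]] : b - a = 0 \/ 1 <= b - a \/ b - a <= - 1 by lia.
- by move: kE; rewrite k mul0r; lia.
- have : 1 * Q <= (b - a) * Q by rewrite ler_pM2r.
  lia.
have : (b - a) * Q <= - 1 * Q by rewrite ler_pM2r.
lia.
Qed.

Lemma reduced0 : reduced (s, 1).
Proof. by apply/and5P; split=> //=; lia. Qed.

Lemma iter_reduced n : reduced (iter n cf_step (s, 1)).
Proof. by elim: n => [|n IH]; [exact: reduced0 | case: (cf_stepP IH)]. Qed.

(** There are finitely many reduced pairs, and an injective map on a finite set
    has only periodic points. *)
Lemma cf_periodic : exists2 n, (0 < n)%N & iter n cf_step (s, 1) = (s, 1).
Proof.
pose T := ('I_(`|s|.+1) * 'I_((`|s|).*2.+1))%type.
pose f (i : 'I_#|{: T}|.+1) : T :=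
  let x := iter i cf_step (s, 1) in (inord `|x.1|, inord `|x.2|).
have : ~~ injectiveb f.
  by apply/negP=> /injectiveP /leq_card; rewrite card_ord ltnn.
case/injectivePn=> i [j ij fij].
wlog {ij} ltij : i j fij / (i < j)%N.
  move=> th; case: (ltngtP i j) => [||e]; [exact: th|exact: th|].
  by case/eqP: ij; apply: val_inj.
have {fij} : iter i cf_step (s, 1) = iter j cf_step (s, 1).
  case: fij; move: (iter_reduced i) (iter_reduced j).
  case: (iter i _ _) => a b; case: (iter j _ _) => a' b'.
  move=> /and5P[/= ? ? ? ? _] /and5P[/= ? ? ? ? _].
  move=> /(congr1 val) /= e1 /(congr1 val) /= e2.
  by move: e1 e2; rewrite !inordK; try lia; move=> e1 e2; congr pair; lia.
have -> : nat_of_ord j = (i + (j - i))%N by lia.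
have : (0 < j - i)%N by lia.
move: (j - i)%N => n n0; elim: (nat_of_ord i) => [|m IH]; first by exists n.
rewrite addSn /= => /cf_step_inj e; apply: IH; apply: e; exact: iter_reduced.
Qed.

(** h / k and h' / k' are consecutive convergents of sqrt d. The expansion starts
    at the purely periodic number s + sqrt d instead of sqrt d, whence the
    initial values 1/0 and -s/1. The first three equations imply
    h^2 - d k^2 = x.2 or - x.2, where x is the current pair. *)
Lemma cf_convergent n : exists h k h' k' : int,
  [/\ h = (iter n cf_step (s, 1)).1 * k + (iter n cf_step (s, 1)).2 * k',
      d * k = (iter n cf_step (s, 1)).1 * h + (iter n cf_step (s, 1)).2 * h',
      (h * k' - k * h') ^+ 2 = 1, 0 <= k & 0 <= k'] /\
  (0 < k + k' /\ ((0 < n)%N -> 0 < k)).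
Proof.
elim: n => [|n [h [k [h' [k' [[hE dkE det k0 k0'] [kk _]]]]]]].
  exists 1, 0, (- s), 1 => /=; split; last by [].
  by split=> //; ring.
rewrite iterS; have := cf_stepP (iter_reduced n).
have /and5P[P0 Ps Ql _ _] := iter_reduced n.
have {P0 Ps Ql} Q0 : 0 < (iter n cf_step (s, 1)).2 by lia.
move: (iter n cf_step _) (cf_step _) Q0 hE dkE => [P Q] [A B] /= Q0 hE dkE.
move: (cf_quotient _) => a [a0 AE QB /and5P[/= A0 _ _ _ _] _].
have {}Q0 : Q != 0 by rewrite gt_eqF.
have ak : k <= a * k by rewrite ler_peMl //; lia.
have aQ : a * Q = A + P by lia.
have Qk' : Q * k' = h - P * k by lia.
have Qh' : Q * h' = d * k - P * h by lia.
exists (a * h + h'), (a * k + k'), h, k; split; last by split; lia.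
split=> //; last by lia.
- apply: (mulfI Q0).
  transitivity (a * Q * h + Q * h'); first by ring.
  transitivity (A * (a * Q * k + Q * k') + Q * B * k); last by ring.
  by rewrite aQ Qk' Qh' QB; ring.
- apply: (mulfI Q0).
  transitivity (d * (a * Q * k + Q * k')); first by ring.
  transitivity (A * (a * Q * h + Q * h') + Q * B * h); last by ring.
  by rewrite aQ Qk' Qh' QB; ring.
by rewrite -det; ring.
Qed.

End ContinuedFraction.

(** After one period the denominator is 1 again, so h^2 - d k^2 = 1 or -1; the
    square of h + k sqrt d removes the sign. *)
Theorem pell_solution (d : nat) : (forall s, s ^ 2 != d)%N ->
  exists x y : nat, (0 < y /\ x ^ 2 = d * y ^ 2 + 1)%N.
Proof.
move=> nsq.
have [s /andP[sl su]] : exists s, (s ^ 2 < d < s.+1 ^ 2)%N.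
  have d0 : (0 ^ 2 <= d)%N by [].
  have ub s : (s ^ 2 <= d -> s <= d)%N.
    by apply: leq_trans; rewrite -{1}[s]muln1 expnS expn1 leq_mul2l; case: (s).
  have ex : exists s, (s ^ 2 <= d)%N by exists 0%N.
  have [s sd smax] := ex_maxnP ex ub.
  exists s; rewrite ltn_neqAle nsq sd /= ltnNge; apply/negP=> /smax.
  by rewrite ltnn.
have s0 : (0 < s)%N.
  rewrite lt0n; apply/eqP=> s0; subst s; move: su sl; rewrite exp1n; lia.
pose D : int := d; pose S : int := s.
have S0 : 0 < S by lia.
have Sl : S ^+ 2 < D by rewrite /S /D -[_ ^+ 2]rmorphXn ltz_nat.
have Su : D < (S + 1) ^+ 2 by rewrite /S /D -[(_ + 1)]/(_%:Z) addn1 -rmorphXn ltz_nat.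
have [n n0 per] := cf_periodic S0 Sl Su.
have [h [k [h' [k' /= [[hE dkE det k0 k0'] [_ /(_ n0) {}k0]]]]]] :=
  cf_convergent S0 Sl Su n.
rewrite per /= in hE dkE.
have N1 : (h ^+ 2 - D * k ^+ 2) ^+ 2 = 1.
  rewrite -det; congr (_ ^+ 2); rewrite [D * _]mulrA dkE.
  have -> : k' = h - S * k by lia.
  ring.
have sq_abs (z : int) : (`|z| ^ 2)%N = z ^+ 2 :> int.
  by rewrite -mulnn PoszM abszE -normrM ger0_norm ?sqr_ge0 ?expr2 // -expr2 sqr_ge0.
exists `|(h ^+ 2 + D * k ^+ 2)%R|%N, `|(2 * h * k)%R|%N; split.
  by rewrite absz_gt0 !mulf_neq0 //; lia.
apply/eqP; rewrite -eqz_nat PoszD PoszM !sq_abs -/D; apply/eqP.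
have -> : (h ^+ 2 + D * k ^+ 2) ^+ 2
    = (h ^+ 2 - D * k ^+ 2) ^+ 2 + D * (2 * h * k) ^+ 2.
  by ring.
by rewrite N1 addrC.
Qed.

Section SquarefreeDescent.
Local Open Scope nat_scope.

Definition squarefree d := forall l, prime l -> ~~ (l ^ 2 %| d).

Lemma squarefree_coprime u v : squarefree (u * v) -> coprime u v.
Proof.
move=> sqf; rewrite /coprime; apply/negPn/negP=> g1.
have : prime (pdiv (gcdn u v)).
  apply: pdiv_prime; rewrite ltn_neqAle eq_sym g1 /= gcdn_gt0.
  case: (posnP u) => //= u0; case: (posnP v) => // v0.
  by have := sqf 2 isT; rewrite u0 mul0n dvdn0.
move=> lp; have := sqf _ lp; rewrite -mulnn dvdn_mul //.
  by rewrite (dvdn_trans (pdiv_dvd _)) ?dvdn_gcdl.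
by rewrite (dvdn_trans (pdiv_dvd _)) ?dvdn_gcdr.
Qed.

Lemma coprime_mul_square m n z : coprime m n -> m * n = z ^ 2 -> m = gcdn m z ^ 2.
Proof.
move=> cmn mnz; case: (posnP m) => [m0|m0].
  move: cmn mnz; rewrite m0 /coprime !gcd0n => _ /esym/eqP.
  by rewrite mul0n expn_eq0 andbT => /eqP ->.
have g0 : 0 < gcdn m z by rewrite gcdn_gt0 m0.
have [m' mE] := dvdnP (dvdn_gcdl m z); have [z' zE] := dvdnP (dvdn_gcdr m z).
set g := gcdn m z in g0 mE zE *.
have cmz : coprime m' z'.
  by rewrite /coprime -(eqn_pmul2r g0) muln_gcdl -mE -zE mul1n eqxx.
have e : m' * n = z' ^ 2 * g.
  apply/eqP; rewrite -(eqn_pmul2r g0) -mulnA [n * g]mulnC mulnA -mE mnz zE expnMn.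
  by rewrite -mulnA mulnn.
have m'g : m' %| g.
  by rewrite -(Gauss_dvdr _ (_ : coprime m' (z' ^ 2))) ?coprimeXr // -e dvdn_mulr.
have gm' : g %| m'.
  rewrite -(Gauss_dvdl _ (_ : coprime g n)) ?e ?dvdn_mull //.
  by apply: coprime_dvdl cmn; rewrite mE dvdn_mull.
have gm : m' = g by apply/eqP; rewrite eqn_dvd m'g gm'.
by rewrite mE gm mulnn.
Qed.

(** v is the common divisor of m and d; since d is squarefree, u = d / v is prime
    to m and divides n, and the two cofactors are coprime with product z^2. *)
Lemma coprime_mul_squarefree d m n z : squarefree d -> coprime m n ->
  m * n = d * z ^ 2 ->
  exists u v a b, [/\ u * v = d, n = u * a ^ 2, m = v * b ^ 2 & z = a * b].
Proof.
move=> sqf cmn e.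
have d0 : 0 < d by case: d sqf {e} => // /(_ 2 isT).
set v := gcdn m d; pose u := d %/ v.
have v0 : 0 < v by rewrite gcdn_gt0 d0 orbT.
have uv : u * v = d by rewrite divnK // dvdn_gcdr.
have [m' mE] := dvdnP (dvdn_gcdl m d).
rewrite -/v in mE.
have cuv : coprime u v by apply: squarefree_coprime; rewrite uv.
have cum : coprime u m'.
  have : coprime m' u.
    rewrite /coprime -(eqn_pmul2r v0) mul1n muln_gcdl.
    by rewrite -mE uv eqxx.
  by rewrite coprime_sym.
have e1 : m' * n = u * z ^ 2.
  by apply/eqP; rewrite -(eqn_pmul2r v0) mulnAC -mE e -uv mulnAC.
have [n' nE] : exists n', n = n' * u.
  by apply/dvdnP; rewrite -(Gauss_dvdr _ cum) e1 dvdn_mulr.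
have u0 : 0 < u by move: d0; rewrite -uv; case: (u).
have e2 : m' * n' = z ^ 2.
  by apply/eqP; rewrite -(eqn_pmul2l u0) -e1 nE mulnC -mulnA eqxx.
have c2 : coprime m' n'.
  apply: coprime_dvdl (coprime_dvdr _ cmn); first by rewrite mE dvdn_mulr.
  by rewrite nE dvdn_mulr.
have m'E := coprime_mul_square c2 e2.
have n'E : n' = gcdn n' z ^ 2.
  by apply: (@coprime_mul_square _ m'); [rewrite coprime_sym | rewrite mulnC].
exists u, v, (gcdn n' z), (gcdn m' z); split=> //.
- by rewrite -n'E mulnC.
- by rewrite -m'E mulnC.
apply/eqP; rewrite -eqn_sqr expnMn -n'E -m'E mulnC; exact/eqP.
Qed.

Lemma leq_square n : n <= n ^ 2.
Proof. by case: n => // n; rewrite expnS leq_pmulr. Qed.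

(** From the least y > 0 with x^2 = d y^2 + 1. If x is odd, (x - 1)/2 and
    (x + 1)/2 are coprime, which gives c = 1; then u = 1 would be a smaller
    solution, and v = 1 would make -1 a square modulo d. If x is even, x - 1
    and x + 1 are coprime, which gives c = 2. *)
Lemma pell_descent d : 1 < d -> odd d -> squarefree d ->
    (forall b, ~~ (d %| b ^ 2 + 1)) ->
  exists u v a b c, [/\ u * v = d, u * a ^ 2 = v * b ^ 2 + c &
    [/\ c = 1, u != 1 & v != 1] \/ (c = 2 /\ d = 3 %[mod 4])].
Proof.
move=> d1 oddd sqf nm1.
have nsq s : (s ^ 2 != d).
  apply: contraTneq d1 => sd; rewrite -sd -leqNgt.
  have [s1|s1] := leqP s 1; first by case: s s1 {sd} => [|[]].
  have := sqf _ (pdiv_prime s1).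
  by rewrite -sd dvdn_exp2r // pdiv_dvd.
have ex : exists y, (0 < y) && [exists x : 'I_(d * y ^ 2 + 2), x ^ 2 == d * y ^ 2 + 1].
  have [x [y [y0 xE]]] := pell_solution nsq; exists y; rewrite y0.
  have xl : x < d * y ^ 2 + 2.
    apply: leq_ltn_trans (leq_square x) _; by rewrite xE ltn_add2l.
  by apply/existsP; exists (Ordinal xl); rewrite /= xE.
have [y /andP[y0 /existsP[[x /= _] /eqP xE]] ymin] := ex_minnP ex.
have {ymin} ymin a b : 0 < b -> a ^ 2 = d * b ^ 2 + 1 -> y <= b.
  move=> b0 aE; apply: ymin; rewrite b0.
  have al : a < d * b ^ 2 + 2.
    apply: leq_ltn_trans (leq_square a) _; by rewrite aE ltn_add2l.
  by apply/existsP; exists (Ordinal al); rewrite /= aE.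
have [oddx | evx] := boolP (odd x).
  have [m xm] : exists m, x = m.*2.+1.
    by exists x./2; rewrite -[LHS]odd_double_half oddx.
  have evy : ~~ odd y.
    have := congr1 odd xE; rewrite oddD oddX oddM oddX oddx oddd /=; by case: (odd y).
  have [z yz] : exists z, y = z.*2 by exists y./2; rewrite even_halfK.
  have e : m * m.+1 = d * z ^ 2 by move: xE; rewrite xm yz; clear; nia.
  have [u [v [a [b [uv nE mE zE]]]]] := coprime_mul_squarefree sqf (coprimenS m) e.
  exists u, v, a, b, 1; split=> //; first by rewrite -nE -mE addn1.
  left; split=> //; apply/eqP.
    move=> u1; move: uv nE; rewrite u1 !mul1n => vd aE.
    have b0 : 0 < b by case: b zE {mE} => //; rewrite muln0 => z0; move: y0; rewrite yz z0.
    have : y <= b by apply: (ymin a) => //; rewrite -aE -vd -mE addn1.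
    have a0 : 0 < a by case: a zE {aE} => // z0; move: y0; rewrite yz z0.
    by rewrite yz zE => yb; have := leq_pmull b a0; clear -b0 yb; lia.
  move=> v1; move: uv mE; rewrite v1 !mul1n muln1 => ud bE.
  by have := nm1 b; rewrite -bE addn1 nE ud dvdn_mulr.
have x0 : 0 < x by case: x evx xE => // _; rewrite addn1.
have [m xm] : exists m, x = m.+1 by exists x.-1; rewrite prednK.
have e : m * m.+2 = d * y ^ 2 by move: xE; rewrite xm; clear; nia.
have cm : coprime m m.+2.
  rewrite /coprime -[m.+2]addn2 gcdnDl -/(coprime m 2) coprimen2.
  by move: evx; rewrite xm /= negbK.
have [u [v [a [b [uv nE mE zE]]]]] := coprime_mul_squarefree sqf cm e.
exists u, v, a, b, 2; split=> //; first by rewrite -nE -mE addn2.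
right; split=> //.
have oddy : odd y.
  have := congr1 odd xE; rewrite oddD oddX oddM oddX (negPf evx) oddd /=; by case: (odd y).
have [z yz] : exists z, y = z.*2.+1.
  by exists y./2; rewrite -[LHS]odd_double_half oddy.
have [w xw] : exists w, x = w.*2 by exists x./2; rewrite even_halfK.
move: xE; rewrite yz xw => h.
have : d + 1 + 4 * (d * (z ^ 2 + z)) = 4 * w ^ 2.
  by move: h; rewrite -!muln2 !expnS !expn0; clear; nia.
move: (d * _) (w ^ 2); lia.
Qed.

Lemma prime_mul_split l n u v : prime l -> u * v = l * n ->
  exists (b : bool) u' v', [/\ u = l ^ b * u', v = l ^ (~~ b) * v' & u' * v' = n].
Proof.
move=> lp e; have l0 := prime_gt0 lp.
have : l %| u * v by rewrite e dvdn_mulr.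
rewrite Euclid_dvdM // => /orP[] /dvdnP[w wE]; subst.
  exists true, w, v; rewrite expn1 expn0 mul1n mulnC; split=> //.
  by apply/eqP; rewrite -(eqn_pmul2l l0) -e mulnA [l * w]mulnC.
exists false, u, w; rewrite expn1 expn0 mul1n [w * l]mulnC; split=> //.
by apply/eqP; rewrite -(eqn_pmul2l l0) -e mulnCA [l * w]mulnC.
Qed.

Lemma squarefree1 : squarefree 1.
Proof.
move=> l lp; rewrite dvdn1 gtn_eqF //.
by apply: leq_trans (leq_square l); apply: prime_gt1.
Qed.

Lemma squarefreeM l d : prime l -> ~~ (l %| d) -> squarefree d -> squarefree (l * d).
Proof.
move=> lp ld sqf k kp; have [->|kl] := eqVneq k l.
  by rewrite -mulnn dvdn_pmul2l // prime_gt0.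
by rewrite Gauss_dvdr ?sqf // coprimeXl // prime_coprime // dvdn_prime2.
Qed.

Lemma prime_split p u v : prime p -> u * v = p ->
  exists b : bool, u = p ^ b /\ v = p ^ (~~ b).
Proof.
move=> pp uv; have [|b [u' [v' [-> -> /eqP]]]] := @prime_mul_split p 1 u v pp.
  by rewrite muln1.
by rewrite muln_eq1 => /andP[/eqP -> /eqP ->]; exists b; rewrite !muln1.
Qed.

Lemma prime3_split q r s u v : prime q -> prime r -> prime s -> u * v = q * r * s ->
  exists bq br bs : bool, u = q ^ bq * r ^ br * s ^ bs /\
    v = q ^ (~~ bq) * r ^ (~~ br) * s ^ (~~ bs).
Proof.
move=> qp rp sp; rewrite -mulnA.
move/(prime_mul_split qp)=> [bq [u1 [v1 [-> -> /(prime_mul_split rp)]]]].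
move=> [br [u2 [v2 [-> -> /(prime_split sp)[bs [-> ->]]]]]].
by exists bq, br, bs; rewrite !mulnA.
Qed.

Lemma squarefree_prime p : prime p -> squarefree p.
Proof.
move=> pp; rewrite -[p]muln1; apply: squarefreeM squarefree1 => //.
by rewrite dvdn1 gtn_eqF ?prime_gt1.
Qed.

End SquarefreeDescent.

(** * Maximal ideals and their finite products *)

Section MaximalIdeals.
Local Open Scope classical_set_scope.
Variable R : comNzRingType.
Implicit Types (I J M : set R) (x y a : R).

Lemma ideal_opp I x : is_ideal I -> I x -> I (- x).
Proof. by move=> [_ _ IM] Ix; rewrite -mulN1r; apply: IM. Qed.

Lemma ideal_sub I x y : is_ideal I -> I x -> I y -> I (x - y).
Proof. by move=> II Ix Iy; have [_ ID _] := II; apply: ID => //; apply: ideal_opp. Qed.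

Lemma ideal_eqT I : is_ideal I -> I 1 -> I = setT.
Proof.
by move=> [_ _ IM] I1; apply/seteqP; split=> // x _; rewrite -[x]mulr1; apply: IM.
Qed.

Lemma maximal_proper M : is_maximal_ideal M -> ~ M 1.
Proof. by move=> [MI MT _] /(ideal_eqT MI). Qed.

Lemma maximal_prime M x y : is_maximal_ideal M -> M (x * y) -> M x \/ M y.
Proof.
move=> [MI MT Mmax] Mxy; have [M0 MD MM] := MI.
pose J := [set z | exists m a, M m /\ z = m + a * x].
have JI : is_ideal J.
  split.
  - by exists 0, 0; rewrite mul0r addr0.
  - move=> _ _ [m [a [Mm ->]]] [n [b [Mn ->]]].
    by exists (m + n), (a + b); split; [exact: MD | ring].
  - move=> b _ [m [a [Mm ->]]].
    by exists (b * m), (b * a); split; [exact: MM | ring].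
have MJ : M `<=` J by move=> m Mm; exists m, 0; rewrite mul0r addr0.
case: (Mmax J JI MJ) => [JM|JT].
  by left; rewrite -JM; exists 0, 1; rewrite mul1r add0r.
right; have [m [a [Mm e]]] : J 1 by rewrite JT.
rewrite -[y]mul1r e mulrDl -mulrA; apply: MD; last exact: MM.
by rewrite mulrC; apply: MM.
Qed.

Lemma maximal_expn M x n : is_maximal_ideal M -> M (x ^+ n) -> M x.
Proof.
move=> Mm; elim: n => [/(maximal_proper Mm)//|n IH].
by rewrite exprS => /(maximal_prime Mm)[|/IH].
Qed.

Lemma maximal_comaximal M N : is_maximal_ideal M -> is_maximal_ideal N ->
  M <> N -> exists2 j, N j & M (1 - j).
Proof.
move=> [MI MT Mmax] [NI NT Nmax] MN; have [M0 MD MM] := MI; have [N0 ND NM] := NI.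
pose J := [set z | exists m n, [/\ M m, N n & z = m + n]].
have JI : is_ideal J.
  split; first by exists 0, 0; rewrite addr0.
  - move=> _ _ [m [n [? ? ->]]] [m' [n' [? ? ->]]].
    by exists (m + m'), (n + n'); split; [exact: MD | exact: ND | ring].
  - move=> b _ [m [n [? ? ->]]].
    by exists (b * m), (b * n); split; [exact: MM | exact: NM | ring].
have MJ : M `<=` J by move=> m Mm; exists m, 0; rewrite addr0.
case: (Mmax J JI MJ) => [JM|JT].
  have NsubM : N `<=` M by move=> n Nn; rewrite -JM; exists 0, n; rewrite add0r.
  by case: (Nmax M MI NsubM) => // e; case: MN.
have [m [n [Mm Nn e]]] : J 1 by rewrite JT.
by exists n; rewrite // e addrK.
Qed.

(** 1 is congruent modulo M to an element of each N t, hence to the product of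
    these elements. *)
Lemma comaximal_prod (T : eqType) (s : seq T) M (N : T -> set R) :
    is_maximal_ideal M -> {in s, forall t, is_maximal_ideal (N t) /\ M <> N t} ->
  exists2 j, {in s, forall t, N t j} & M (1 - j).
Proof.
move=> Mm; have [[M0 MD MM] _ _] := Mm.
elim: s => [|t s IH] sP; first by exists 1; rewrite ?subrr.
have [|j jN Mj] := IH; first by move=> u us; apply: sP; rewrite inE us orbT.
have [Nt MN] := sP t (mem_head _ _).
have [i iN Mi] := maximal_comaximal Mm Nt MN.
exists (i * j); last first.
  by rewrite (_ : _ - _ = (1 - i) + i * (1 - j)); [apply: MD => //; exact: MM | ring].
move=> u; rewrite inE => /orP[/eqP ->|us].
  by have [[_ _ NM] _ _] := Nt; rewrite mulrC; apply: NM.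
have [[[_ _ NM] _ _] _] := sP u (mem_behead (s := t :: s) us).
by apply: NM; apply: jN.
Qed.

(** If j = 1 modulo M and j lies in all the other ideals, an element x of the
    intersection is (1 - j) x + x j, a sum of two products. *)
Lemma prod_maximal (s : seq (set R)) : uniq s -> {in s, forall M, is_maximal_ideal M} ->
  \big[@ideal_mul R/setT]_(M <- s) M = [set x | {in s, forall M, M x}].
Proof.
elim: s => [|M s IH] /=.
  by move=> _ _; rewrite big_nil; apply/seteqP; split=> // x.
move=> /andP[Ms us] sm; rewrite big_cons IH //; last first.
  by move=> N Ns; apply: sm; rewrite inE Ns orbT.
have Mm := sm M (mem_head _ _); have [[M0 MD MM] _ _] := Mm.
apply/seteqP; split=> x.
  move=> [n [a [b [aM bs ->]]]] N Ns.
  have [[N0 ND NM] _ _] := sm N Ns.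
  apply: (big_ind N) => // i _; move: Ns; rewrite inE => /orP[/eqP ->|Ns].
    by rewrite mulrC; apply: MM.
  by apply: NM; apply: bs.
move=> xs; have [|j js Mj] := comaximal_prod (s := s) (N := id) Mm.
  move=> N Ns; split; first by apply: sm; rewrite inE Ns orbT.
  by move=> e; rewrite e Ns in Ms.
exists 2, (fun i => if i == ord0 then 1 - j else x),
  (fun i => if i == ord0 then x else j).
split.
- by move=> i; case: ifP => // _; apply: xs; rewrite mem_head.
- move=> i; case: ifP => _ N Ns; last exact: js.
  by apply: xs; rewrite inE Ns orbT.
by rewrite !big_ord_recl big_ord0 /=; ring.
Qed.

(** The translation by 1 permutes the cosets of I. Comparing the sum of a system
    of representatives before and after, one finds that the number of cosets
    lies in I. *)
Lemma ideal_norm_mem I : is_ideal I -> (0 < ideal_norm I)%N -> I (ideal_norm I)%:R.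
Proof.
move=> II; rewrite /ideal_norm; have [I0 ID IM] := II.
have [fin|nfin] := pselect (finite_set (cosets I)); last first.
  by rewrite /fset_set; case: pselect => //= _; rewrite cardfs0.
set X := fset_set _; have XP C : (C \in X) = (C \in cosets I) by rewrite in_fset_set.
move=> _; pose rep (C : set R) : R := xget 0 C.
pose T (C : set R) : set R := [set 1 + x | x in C].
have repE C : C \in X -> forall x, C x -> I (x - rep C).
  rewrite XP inE => -[c _ <-] x [y Iy <-].
  have : [set c + z | z in I] (rep [set c + z | z in I]).
    by apply: xgetPex; exists (c + y), y.
  move=> [z Iz e]; rewrite -e (_ : _ - _ = y - z); [exact: ideal_sub | ring].
have repP C : C \in X -> C (rep C).
  by rewrite XP inE => -[c _ <-]; apply: xgetPex; exists (c + 0), 0.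
have TX C : C \in X -> T C \in X.
  rewrite !XP !inE => -[c _ <-]; exists (1 + c) => //; apply/seteqP; split=> x.
    by move=> [y Iy <-]; exists (c + y); [exists y | rewrite addrA].
  by move=> [_ [y Iy <-] <-]; exists y; rewrite ?addrA.
have Tinj : injective T.
  move=> C D e; apply/seteqP; split=> x xC.
    have : T D (1 + x) by rewrite -e; exists x.
    by move=> [y Dy /addrI <-].
  have : T C (1 + x) by rewrite e; exists x.
  by move=> [y Dy /addrI <-].
have pm : perm_eq (map T X) X.
  have uT : uniq (map T X) by rewrite (map_inj_uniq Tinj) fset_uniq.
  apply: uniq_perm (fset_uniq X) _ => //.
  have sub : {subset map T X <= X} by move=> _ /mapP[C CX ->]; apply: TX.
  by have [] := uniq_min_size uT sub _; rewrite // size_map.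
have : I (\sum_(C <- X) (1 + rep C - rep (T C))).
  rewrite big_seq; apply: big_ind => // C CX.
  by apply: repE; [exact: TX | exists (rep C) => //; apply: repP].
rewrite !big_split /= sumrN -[X in _ - X](big_map T xpredT rep) (perm_big _ pm) /=.
by rewrite addrK big_const_seq count_predT iter_addr addr0.
Qed.

Section Involution.
Variable g : {rmorphism R -> R}.
Hypothesis gK : involutive g.

Lemma preim_ideal I : is_ideal I -> is_ideal (g @^-1` I).
Proof.
move=> [I0 ID IM]; split; rewrite /preimage /= ?rmorph0 //.
  by move=> x y; rewrite rmorphD; apply: ID.
by move=> a x; rewrite rmorphM; apply: IM.
Qed.

Lemma preimK I : g @^-1` (g @^-1` I) = I.
Proof. by apply/seteqP; split=> x; rewrite /preimage /= gK. Qed.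

Lemma preim_maximal M : is_maximal_ideal M -> is_maximal_ideal (g @^-1` M).
Proof.
move=> Mm; have [MI MT Mmax] := Mm; split; first exact: preim_ideal.
  move=> e; apply: (maximal_proper Mm); have : setT (1 : R) by [].
  by rewrite -e /preimage /= rmorph1.
move=> J JI MJ; have [||e|e] := Mmax (g @^-1` J).
- exact: preim_ideal.
- by move=> x Mx; apply: MJ; rewrite /preimage /= gK.
- by left; rewrite -e preimK.
- by right; rewrite -[J]preimK e.
Qed.

Lemma preim_norm I : ideal_norm (g @^-1` I) = ideal_norm I.
Proof.
have imE J : cosets (g @^-1` J) = (fun C : set R => g @^-1` C) @` cosets J.
  apply/seteqP; split=> C.
    move=> [c _ <-]; exists [set g c + x | x in J]; first by exists (g c).
    apply/seteqP; split=> x; rewrite /preimage /=.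
      by move=> [y Jy e]; exists (g y); rewrite /= ?gK // -[RHS]gK -e rmorphD gK.
    by move=> [y Jy <-]; exists (g y); rewrite ?rmorphD.
  move=> [_ [c _ <-] <-]; exists (g c) => //; apply/seteqP; split=> x; rewrite /preimage /=.
    by move=> [y Jy <-]; exists (g y); rewrite // rmorphD gK.
  by move=> [y Jy e]; exists (g y); rewrite /= ?gK // -[RHS]gK -e rmorphD.
have inj : injective (fun C : set R => g @^-1` C).
  by move=> C D /= e; rewrite -[C]preimK e preimK.
have [fin|nfin] := pselect (finite_set (cosets I)).
  by rewrite /ideal_norm imE fset_set_image // card_imfset.
have nfin' : ~ finite_set (cosets (g @^-1` I)).
  by move=> fin; apply: nfin; rewrite -[I]preimK imE; apply: finite_image.
by rewrite /ideal_norm /fset_set; do 2![case: pselect => //= _]; rewrite !cardfs0.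
Qed.

End Involution.

(** The hypothesis says that for each maximal ideal M above l the intersection of
    the conjugates of M is generated by the same a. A maximal ideal N above l
    that is not conjugate to M would contain a, and also an element 1 - j with
    j in that intersection, hence 1. So the ideals of the product are either
    absent or exactly the conjugates of M, and [prod_maximal] applies. *)
Lemma prod_maximal_orbit (T : finType) (G : T -> {rmorphism R -> R}) (t1 : T)
    (l f : nat) (a : R) :
    prime l -> (forall t, involutive (G t)) -> G t1 =1 id ->
    (forall M, is_maximal_ideal M -> M l%:R ->
       forall x, (forall t, M (G t x)) <-> exists b, x = a * b) ->
  is_principal (\big[@ideal_mul R/setT]_(M \in [set M : set R |
    is_maximal_ideal M /\ ideal_norm M = (l ^ f)%N]) M).
Proof.
move=> lp GK G1 aP; set A := [set M | _].
have Al M : A M -> M l%:R.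
  move=> [Mm e]; have [MI _ _] := Mm; apply: (maximal_expn (n := f) Mm).
  by rewrite -natrX -e; apply: ideal_norm_mem => //; rewrite e expn_gt0 prime_gt0.
have [[M0 AM0]|A0] := pselect (exists M, A M); last first.
  rewrite (_ : A = set0); last by apply/seteqP; split=> // M AM; case: A0; exists M.
  exists 1; case: finite_supportP => [|X XA _ _].
    by move=> _; rewrite big_nil; apply/seteqP; split=> // x _; exists x; rewrite ?mul1r.
  have -> : X = fset0 by apply/fsetP=> M; rewrite inE; apply/negP=> /XA.
  by rewrite big_nil; apply/seteqP; split=> // x _; exists x; rewrite ?mul1r.
have [M0m M0n] := AM0.
have AE : A = [set G t @^-1` M0 | t in setT].
  apply/seteqP; split=> M; last first.
    by move=> [t _ <-]; split; [apply: preim_maximal | rewrite preim_norm].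
  move=> AM; have [Mm Mn] := AM.
  have [//|nM] := pselect ([set G t @^-1` M0 | t in setT] M).
  have [|j jG Mj] := comaximal_prod (s := enum T) (N := fun t => G t @^-1` M0) Mm.
    move=> t _; split; first exact: preim_maximal.
    by move=> e; apply: nM; exists t.
  have Mj' : M j.
    rewrite -(G1 j); apply: (aP M Mm (Al M AM) j).2; apply: (aP M0 M0m (Al _ AM0) j).1.
    by move=> t; apply: jG; rewrite mem_enum.
  by case: (maximal_proper Mm); have [[_ MD _] _ _] := Mm; rewrite -(subrK j 1); apply: MD.
have Afin : finite_set (A `&` id @^-1` [set~ setT]).
  apply: sub_finite_set (_ : finite_set A); first by move=> x [].
  by rewrite AE; apply: finite_image.
exists a; case: finite_supportP => [nfin|X XA sX _]; first by case: nfin.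
have XE M : M \in X <-> A M.
  split=> [/XA //|AM]; apply/negPn/negP=> MX; have [Mm _] := AM.
  by have := sX M AM MX; have [_ MT _] := Mm.
rewrite prod_maximal ?fset_uniq //; last by move=> M /XE [].
apply/seteqP; split=> x.
  move=> xX; have [|b ->] := (aP M0 M0m (Al _ AM0) x).1; last by exists b.
  by move=> t; apply: (xX (G t @^-1` M0)); apply/XE; rewrite AE; exists t.
move=> [b _ <-] M /XE; rewrite AE => -[t _ <-].
by apply: (aP M0 M0m (Al _ AM0) _).2; exists b.
Qed.

End MaximalIdeals.

(** * Automorphisms of a biquadratic field *)

Lemma rat_root_int (q : rat) (p : {poly int}) :
  p \is monic -> root (map_poly intr p) q -> exists z : int, q = z%:~R.
Proof.
move=> pm pq; have : (ratr q : algC) \is a Num.int.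
  apply: Cint_rat_Aint; first by apply: Crat_rat.
  apply: (@root_monic_Aint (map_poly intr p)).
  - rewrite -(fmorph_root (ratr : {rmorphism rat -> algC})) -map_poly_comp in pq.
    rewrite (eq_map_poly (g := intr)) // in pq.
    by move=> z; rewrite /= ratr_int.
  - exact: monic_map.
  - by apply/polyOverP=> i; rewrite coef_map /= intr_int.
by move=> /intrP[z /eqP]; rewrite -ratr_int (inj_eq (fmorph_inj _)) => /eqP; exists z.
Qed.

Lemma squarefree_rat_nonsquare (d : nat) (k : rat) :
  (1 < d)%N -> squarefree d -> k ^+ 2 != d%:R.
Proof.
move=> d1 sqf; apply/eqP=> kd.
have [z zE] : exists z : int, k = z%:~R.
  apply: (@rat_root_int k ('X^2 - d%:R)).
    by rewrite -(rmorph_nat polyC) monicXnsubC.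
  rewrite rmorphB /= map_polyXn rmorph_nat /root -(rmorph_nat polyC).
  by rewrite hornerD hornerN hornerXn hornerC kd subrr.
have /eqP := kd.
rewrite zE -rmorphXn /= -[d%:R]/((d%:Z)%:~R) eqr_int => /eqP dz.
have {}dz : (`|z| ^ 2)%N = d by rewrite -abszX dz.
have z1 : (1 < `|z|)%N.
  rewrite ltnNge; apply/negP=> z1.
  by move: d1 dz; case: `|z|%N z1 => [|[]] //; lia.
by have := sqf _ (pdiv_prime z1); rewrite -dz dvdn_exp2r // pdiv_dvd.
Qed.

Lemma fieldExt_rat_natr_eq0 (K : fieldExtType rat) k : (k%:R == 0 :> K) = (k == 0%N).
Proof. by rewrite -(rmorph_nat (in_alg K)) fmorph_eq0 pnatr_eq0. Qed.

Section Quadratic.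
Variables (F : fieldType) (K : fieldExtType F) (E : {subfield K}) (x : K).
Hypotheses (xE : x ^+ 2 \in E).

Lemma quadratic_decomp y : y \in <<E; x>>%VS ->
  exists a b, [/\ a \in E, b \in E & y = a + b * x].
Proof.
pose S y := exists a b, [/\ a \in E, b \in E & y = a + b * x].
have SD u v : S u -> S v -> S (u + v).
  move=> [a [b [aE bE ->]]] [a' [b' [aE' bE' ->]]].
  by exists (a + a'), (b + b'); rewrite !rpredD //; split=> //; ring.
have SM u v : u \in E -> S v -> S (u * v).
  move=> uE [a [b [aE bE ->]]].
  by exists (u * a), (u * b); rewrite !rpredM //; split=> //; ring.
have SX n : S (x ^+ n).
  elim: n => [|n [a [b [aE bE e]]]].
    by exists 1, 0; rewrite rpred1 rpred0 mul0r addr0.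
  exists (b * x ^+ 2), a; rewrite rpredM //; split=> //.
  by rewrite exprS e; ring.
move=> /Fadjoin_polyP[p pE ->]; rewrite horner_coef.
apply: (big_ind S) => // [|i _]; first by exists 0, 0; rewrite rpred0 mul0r addr0.
by apply: SM => //; apply: (polyOverP pE).
Qed.

Hypotheses (xNE : x \notin E) (genK : <<E; x>>%VS = fullv).

(** Over E the elements 1 and x form a basis of K, and a + b x is sent to
    a - b x. *)
Lemma quadratic_conj : exists g : {rmorphism K -> K},
  g x = - x /\ {in E, forall y, g y = y}.
Proof.
have dec y : exists ab : K * K, [/\ ab.1 \in E, ab.2 \in E & y = ab.1 + ab.2 * x].
  have [|a [b abE]] := @quadratic_decomp y; first by rewrite genK memvf.
  by exists (a, b).
pose c y := projT1 (cid (dec y)).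
have cP y : [/\ (c y).1 \in E, (c y).2 \in E & y = (c y).1 + (c y).2 * x].
  by rewrite /c; case: cid.
pose f y := (c y).1 - (c y).2 * x.
have fE a b : a \in E -> b \in E -> f (a + b * x) = a - b * x.
  move=> aE bE; have [a'E b'E] := cP (a + b * x); rewrite /f.
  move: (c _).1 (c _).2 a'E b'E => a' b' a'E b'E e.
  have e' : (b - b') * x = a' - a.
    rewrite mulrBl; apply/eqP.
    by rewrite subr_eq addrAC eq_sym subr_eq [_ * _ + _]addrC e.
  have bb : b = b'.
    apply/eqP; rewrite -subr_eq0; apply: contraNT xNE => nz.
    by rewrite -[x](mulKf nz) e' rpredM ?rpredV ?rpredB.
  by move: e; rewrite bb => /addIr ->.
have fadd : zmod_morphism f.
  move=> y z; have [aE bE {1}->] := cP y; have [a'E b'E {1}->] := cP z.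
  rewrite (_ : _ - _ = ((c y).1 - (c z).1) + ((c y).2 - (c z).2) * x); last by ring.
  by rewrite fE ?rpredB // /f; ring.
have fmul : monoid_morphism f.
  split; first by rewrite -[1]addr0 -(mul0r x) fE ?rpred1 ?rpred0 // mul0r subr0 addr0.
  move=> y z; have [aE bE {1}->] := cP y; have [a'E b'E {1}->] := cP z.
  rewrite (_ : (_ + _) * (_ + _) = ((c y).1 * (c z).1 + (c y).2 * (c z).2 * x ^+ 2)
    + ((c y).1 * (c z).2 + (c y).2 * (c z).1) * x); last by ring.
  rewrite fE; first by rewrite /f; ring.
    apply: rpredD; first exact: rpredM.
    by apply: rpredM => //; apply: rpredM.
  by rewrite rpredD ?rpredM.
pose fa := GRing.isZmodMorphism.Build K K f fadd.
pose fm := GRing.isMonoidMorphism.Build K K f fmul.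
pose g : {rmorphism K -> K} := HB.pack f fa fm.
exists g; split=> [|y yE] /=.
  by rewrite -[x]add0r -[X in 0 + X]mul1r fE ?rpred0 ?rpred1 // sub0r mul1r add0r.
by rewrite -[y]addr0 -(mul0r x) fE ?rpred0 // mul0r subr0 addr0.
Qed.

End Quadratic.

Section Biquadratic.
Variables (K : fieldExtType rat) (m n : nat) (P Q : K).
Hypotheses (P2 : P ^+ 2 = m%:R) (Q2 : Q ^+ 2 = n%:R).
Hypotheses (genK : <<1 & [:: P; Q]>>%VS = fullv).
Hypotheses (nsqm : forall k : rat, k ^+ 2 != m%:R)
  (nsqn : forall k : rat, k ^+ 2 != n%:R)
  (nsqmn : forall k : rat, k ^+ 2 != (m * n)%:R).

(** Each of P and Q generates a quadratic extension of the field generated by the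
    other; sg and tau are the two conjugations. An element fixed by both is the
    average of its conjugates, hence rational, and a rational algebraic integer
    is an integer. *)
Lemma biquadratic_conj : exists sg tau : {rmorphism K -> K},
  [/\ involutive sg, involutive tau & forall x, sg (tau x) = tau (sg x)] /\
  [/\ sg P = - P, sg Q = Q, tau P = P, tau Q = - Q
    & forall x, sg x = x -> tau x = x -> x \in algint (K := K) ->
      exists z : int, x = z%:~R].
Proof.
have inj_alg : injective (in_alg K) by apply: fmorph_inj.
have notin1 (R : K) (k : nat) :
    R ^+ 2 = k%:R -> (forall q : rat, q ^+ 2 != k%:R) -> R \notin 1%VS.
  move=> R2 nsq; apply/negP=> /vlineP[q Rq]; case/eqP: (nsq q).
  by apply: inj_alg; rewrite rmorphXn rmorph_nat -R2 Rq.
have mem1nat (k : nat) (E : {subfield K}) : k%:R \in E by rewrite rpred_nat.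
have notin2 (R S : K) (k l : nat) : R ^+ 2 = k%:R -> S ^+ 2 = l%:R ->
    (forall q : rat, q ^+ 2 != k%:R) -> (forall q : rat, q ^+ 2 != l%:R) ->
    (forall q : rat, q ^+ 2 != (k * l)%:R) -> S \notin <<1; R>>%VS.
  move=> R2 S2 nk nl nkl.
  apply/negP=> /quadratic_decomp[|a [b [/vlineP[a' aE] /vlineP[b' bE] e]]].
    by rewrite R2 mem1nat.
  have e2 : 2 * a * b * R = l%:R - a ^+ 2 - b ^+ 2 * k%:R.
    by rewrite -R2 -S2 e; ring.
  have ab0 : 2 * a * b = 0.
    apply/eqP; apply: contraNT (notin1 _ _ R2 nk) => nz.
    rewrite -[R](mulKf nz) e2 aE bE -[1]/(1 : K).
    by rewrite !(rpredM, rpredB, rpredX, rpredV, rpred_nat, memvZ, mem1v).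
  move/eqP: ab0; rewrite !mulf_eq0 fieldExt_rat_natr_eq0 /= => /orP[]/eqP z0.
    case/eqP: (nkl (b' * k%:R)); apply: inj_alg.
    rewrite rmorphXn rmorphM !rmorph_nat natrM -S2 e z0 add0r bE.
    rewrite [X in _ = _ * X]exprMn R2 /=; ring.
  case/eqP: (nl a'); apply: inj_alg.
  by rewrite rmorphXn rmorph_nat -S2 e z0 mul0r addr0 aE.
have [PN1 QN1] := (notin1 _ _ P2 nsqm, notin1 _ _ Q2 nsqn).
have QNP := notin2 _ _ _ _ P2 Q2 nsqm nsqn nsqmn.
have PNQ := notin2 _ _ _ _ Q2 P2 nsqn nsqm.
rewrite mulnC in PNQ; have {}PNQ := PNQ nsqmn.
have gPQ : <<<<1; P>>; Q>>%VS = fullv by rewrite -genK adjoin_cons adjoin_seq1.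
have gQP : <<<<1; Q>>; P>>%VS = fullv.
  rewrite -adjoin_seq1 -adjoin_cons -genK; apply/eqP; rewrite eqEsubv.
  by rewrite !adjoin_seqSr // => z; rewrite !inE orbC.
have Q2in E : Q ^+ 2 \in (E : {subfield K}) by rewrite Q2.
have P2in E : P ^+ 2 \in (E : {subfield K}) by rewrite P2.
have [tau [tauQ tauE]] := quadratic_conj (Q2in _) QNP gPQ.
have [sg [sgP sgE]] := quadratic_conj (P2in _) PNQ gQP.
have tauP : tau P = P by apply: tauE; apply: memv_adjoin.
have sgQ : sg Q = Q by apply: sgE; apply: memv_adjoin.
have tau1 y : y \in 1%VS -> tau y = y.
  by move=> y1; apply: tauE; apply: subvP y1; apply: subv_adjoin.
have sg1 y : y \in 1%VS -> sg y = y.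
  by move=> y1; apply: sgE; apply: subvP y1; apply: subv_adjoin.
have decE x : exists a b, [/\ a \in <<1; Q>>%VS, b \in <<1; Q>>%VS & x = a + b * P].
  by apply: quadratic_decomp; rewrite ?P2in // gQP memvf.
have decQ x : x \in <<1; Q>>%VS ->
    exists a b, [/\ a \in 1%VS, b \in 1%VS & x = a + b * Q].
  by apply: quadratic_decomp.
have dec x : exists a b c d : K,
    [/\ [/\ a \in 1%VS, b \in 1%VS, c \in 1%VS & d \in 1%VS]
    & x = a + b * Q + (c + d * Q) * P].
  have [u [v [/decQ[a [b [a1 b1 ->]]] /decQ[c [d [c1 d1 ->]]] ->]]] := decE x.
  by exists a, b, c, d.
have sgX a b c d : a \in 1%VS -> b \in 1%VS -> c \in 1%VS -> d \in 1%VS ->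
    sg (a + b * Q + (c + d * Q) * P) = a + b * Q + (- c + - d * Q) * P.
  move=> a1 b1 c1 d1; rewrite !(rmorphD, rmorphM) /= sgQ sgP.
  rewrite (sg1 a) // (sg1 b) // (sg1 c) // (sg1 d) //; ring.
have tauX a b c d : a \in 1%VS -> b \in 1%VS -> c \in 1%VS -> d \in 1%VS ->
    tau (a + b * Q + (c + d * Q) * P) = a + - b * Q + (c + - d * Q) * P.
  move=> a1 b1 c1 d1; rewrite !(rmorphD, rmorphM) /= tauQ tauP.
  rewrite (tau1 a) // (tau1 b) // (tau1 c) // (tau1 d) //; ring.
exists sg, tau; split; first split=> x.
- have [a [b [c [d [[a1 b1 c1 d1] ->]]]]] := dec x.
  by rewrite !sgX ?rpredN // !opprK.
- have [a [b [c [d [[a1 b1 c1 d1] ->]]]]] := dec x.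
  by rewrite !tauX ?rpredN // !opprK.
- have [a [b [c [d [[a1 b1 c1 d1] ->]]]]] := dec x.
  by rewrite tauX ?rpredN // !sgX ?rpredN // tauX ?rpredN // opprK.
split=> // x sx tx xint.
have [a [b [c [d [[a1 b1 c1 d1] xE]]]]] := dec x.
have xa : x = a.
  have : 4 * x = 4 * a.
    have -> : 4 * x = x + sg x + tau x + sg (tau x) by rewrite tx sx; ring.
    rewrite xE tauX // !sgX ?rpredN //; ring.
  by apply: mulfI; rewrite fieldExt_rat_natr_eq0.
have /vlineP[q aq] := a1.
move/algintP: xint; rewrite xa aq => -[p pm pr].
have [|z ->] := rat_root_int (q := q) pm; last first.
  by exists z; exact: (rmorph_int (in_alg K)).
rewrite -(fmorph_root (in_alg K)) -map_poly_comp.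
by rewrite (eq_map_poly (g := intr)) // => z; exact: (rmorph_int (in_alg K)).
Qed.

End Biquadratic.

(** * Galois-stable ideals of the ring of integers *)

Section AlgebraicIntegers.
Variable K : fieldExtType rat.
Local Notation Z := (algint (K := K)).
Implicit Types x y : K.

Lemma algint_root (p : {poly K}) x :
  p \is monic -> root p x -> p \is a polyOver Z -> x \in Z.
Proof.
move=> pm px pZ; apply/algintP.
apply: (@integral_root_monic _ _ intr x p) => // c /(nthP 0)[i _ <-].
exact/algintP/(polyOverP pZ).
Qed.

Lemma algint_quadratic x t n : t \in Z -> n \in Z -> x ^+ 2 = t * x - n -> x \in Z.
Proof.
move=> tZ nZ xE; pose q : {poly K} := - t *: 'X + n%:P.
have sq : (size q < size ('X^2 : {poly K}))%N.
  rewrite size_polyXn ltnS (leq_trans (size_polyD _ _)) // geq_max.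
  rewrite (leq_trans (size_scale_leq _ _)) ?size_polyX //.
  by rewrite (leq_trans (size_polyC_leq1 _)).
apply: (@algint_root ('X^2 + q)).
- by rewrite monicE lead_coefDl // lead_coefXn.
- rewrite /root hornerD hornerXn xE hornerD hornerZ hornerX hornerC; apply/eqP; ring.
- rewrite rpredD // ?rpredX ?polyOverX // rpredD ?polyOverC //.
  by rewrite polyOverZ ?polyOverX // rpredN.
Qed.

Lemma algint_sqr x : x ^+ 2 \in Z -> x \in Z.
Proof.
move=> x2; apply: (@algint_quadratic x 0 (- x ^+ 2)); rewrite ?rpred0 ?rpredN //.
by rewrite mul0r sub0r opprK.
Qed.

(** Bezout: x is a combination of a x and b x. *)
Lemma algint_coprime (a b : nat) x : coprime a b ->
  a%:R * x \in Z -> b%:R * x \in Z -> x \in Z.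
Proof.
move=> cab aZ bZ; have [u [v uv]] := Bezoutz a b.
rewrite (_ : x = u%:~R * (a%:R * x) + v%:~R * (b%:R * x)).
  by rewrite rpredD // rpredM // rpred_int.
rewrite !mulrA -mulrDl !pmulrn -!intrM -intrD uv.
by rewrite /gcdz /= (eqP cab) mul1r.
Qed.

Lemma algint_rmorph (g : {rmorphism K -> K}) x : x \in Z -> g x \in Z.
Proof.
move=> /algintP[p pm px]; apply/algintP; exists p => //.
move: px; rewrite -(fmorph_root g) -map_poly_comp.
by rewrite (eq_map_poly (g := intr)) // => z; rewrite /= rmorph_int.
Qed.

Definition roi_map (g : {rmorphism K -> K}) (x : ring_of_integers K) :=
  RingOfIntegers (algint_rmorph g (roi_valP x)).

Lemma roi_map_zmod g : zmod_morphism (roi_map g).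
Proof. by move=> x y; apply: val_inj; rewrite /= rmorphB. Qed.

Lemma roi_map_monoid g : monoid_morphism (roi_map g).
Proof. by split=> [|x y]; apply: val_inj; rewrite /= (rmorph1, rmorphM). Qed.

HB.instance Definition _ g :=
  GRing.isZmodMorphism.Build _ _ (roi_map g) (roi_map_zmod g).
HB.instance Definition _ g :=
  GRing.isMonoidMorphism.Build _ _ (roi_map g) (roi_map_monoid g).

End AlgebraicIntegers.

Section StableIdeals.
Variables (K : fieldExtType rat) (m n : nat) (P Q : K) (sg tau : {rmorphism K -> K}).
Hypotheses (P2 : P ^+ 2 = m%:R) (Q2 : Q ^+ 2 = n%:R).
Hypotheses (sgK : involutive sg) (tauK : involutive tau).
Hypothesis (sgtau : forall x, sg (tau x) = tau (sg x)).
Hypotheses (sgP : sg P = - P) (sgQ : sg Q = Q) (tauP : tau P = P) (tauQ : tau Q = - Q).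
Local Notation Z := (algint (K := K)).
Hypothesis fixed_int : forall x, sg x = x -> tau x = x -> x \in Z ->
  exists z : int, x = z%:~R.

(** The properties used of the intersection of the conjugates of a maximal ideal
    above l, seen inside K. *)
Definition stable_ideal_over (l : nat) (J : K -> Prop) :=
  [/\ forall x, J x -> x \in Z,
      forall x y, J x -> J y -> J (x + y),
      forall a x, a \in Z -> J x -> J (a * x),
      (forall x, J x -> J (sg x)) /\ (forall x, J x -> J (tau x))
    & forall z : int, J z%:~R -> (l %| z)%Z].

Lemma PZ : P \in Z. Proof. by apply: algint_sqr; rewrite P2 rpred_nat. Qed.
Lemma QZ : Q \in Z. Proof. by apply: algint_sqr; rewrite Q2 rpred_nat. Qed.

Lemma stable_ideal_int l J x : stable_ideal_over l J -> J x -> sg x = x -> tau x = x ->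
  exists z : int, x = l%:R * z%:~R.
Proof.
move=> [JZ _ _ _ Jl] Jx sx tx; have [w wE] := fixed_int sx tx (JZ _ Jx).
have /dvdzP[z zE] : (l %| w)%Z by apply: Jl; rewrite -wE.
by exists z; rewrite wE zE intrM mulrC.
Qed.

(** 4 x is the sum of the four components of x with respect to the characters of
    the Galois group. These components are in J, and 4 is prime to l. *)
Lemma stable_ideal_divides l a J x : stable_ideal_over l J -> coprime l 4 ->
    l%:R / a \in Z ->
    (forall y, J y -> sg y = y \/ sg y = - y -> tau y = y \/ tau y = - y ->
       y / a \in Z) ->
  J x -> x / a \in Z.
Proof.
move=> [JZ JD JM [Jsg Jtau] _] l4 la yP Jx.
have JN y : J y -> J (- y) by rewrite -mulN1r; apply: JM; rewrite rpredN1.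
(* s and t are the values of the character at sg and tau. *)
pose chi (s t : K) := x + s * sg x + t * (tau x + s * tau (sg x)).
have chiZ s t : s = 1 \/ s = -1 -> t = 1 \/ t = -1 -> chi s t / a \in Z.
  move=> s1 t1.
  have sZ : s \in Z by case: s1 => ->; rewrite ?rpred1 ?rpredN1.
  have tZ : t \in Z by case: t1 => ->; rewrite ?rpred1 ?rpredN1.
  apply: yP.
  - apply: (JD); first by apply: (JD) => //; apply: (JM) => //; apply: Jsg.
    apply: (JM) => //; apply: (JD); first exact: Jtau.
    by apply: (JM) => //; apply/Jtau/Jsg.
  - have -> : sg (chi s t) = s * chi s t; last by case: s1 => ->; [left|right]; ring.
    rewrite /chi !(rmorphD, rmorphM) /= !(sgtau, sgK).
    by case: s1 t1 => -> [] ->; rewrite ?(rmorph1, rmorphN1); ring.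
  have -> : tau (chi s t) = t * chi s t; last by case: t1 => ->; [left|right]; ring.
  rewrite /chi !(rmorphD, rmorphM) /= !tauK.
  by case: s1 t1 => -> [] ->; rewrite ?(rmorph1, rmorphN1); ring.
apply: (@algint_coprime _ 4 l); first by rewrite coprime_sym.
  have -> : 4%:R * (x / a)
      = chi 1 1 / a + chi 1 (-1) / a + chi (-1) 1 / a + chi (-1) (-1) / a.
    rewrite /chi -!mulrDl mulrA; congr (_ / _); ring.
  by rewrite !rpredD // chiZ; auto.
by rewrite mulrCA; apply: rpredM => //; apply: JZ.
Qed.

(** The square of a component y is an integer that belongs to J, hence equals l z,
    and (y / a)^2 is z times the unit l / a^2. *)
Lemma ramified_divides l a J x : prime l -> odd l ->
    a ^+ 2 / l%:R \in Z -> l%:R / a ^+ 2 \in Z ->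
    stable_ideal_over l J -> J x -> x / a \in Z.
Proof.
move=> lp lo al la Js; have [JZ JD JM [Jsg Jtau] _] := Js.
have l0 : l%:R != 0 :> K by rewrite fieldExt_rat_natr_eq0 -lt0n prime_gt0.
have a_Z : a \in Z.
  by apply: algint_sqr; rewrite -(divfK l0 (a ^+ 2)) rpredM ?rpred_nat.
apply: (stable_ideal_divides Js) => [||y Jy sy ty].
- by rewrite (@coprimeXr 2 _ 2) // coprimen2.
- have [->|a0] := eqVneq a 0; first by rewrite invr0 mulr0 rpred0.
  by rewrite -[l%:R](divfK (expf_neq0 2 a0)) expr2 mulrA mulfK // rpredM.
have [z zE] : exists z : int, y ^+ 2 = l%:R * z%:~R.
  apply: (stable_ideal_int Js); first by apply: JM => //; apply: JZ.
    by rewrite rmorphXn /=; case: sy => ->; rewrite ?sqrrN.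
  by rewrite rmorphXn /=; case: ty => ->; rewrite ?sqrrN.
by apply: algint_sqr; rewrite expr_div_n zE mulrAC rpredM // rpred_int.
Qed.

(** A component y is a rational multiple of one of 1, P, Q, P Q, say R, so that
    R y is an integer in J, hence a multiple of l. Thus R^2 (y / l) is
    integral, with R^2 an integer prime to l, and so is l (y / l). *)
Lemma unramified_divides l J x : prime l -> odd l -> coprime l (m * n) ->
    stable_ideal_over l J -> J x -> x / l%:R \in Z.
Proof.
move=> lp lo lmn Js; have [JZ JD JM [Jsg Jtau] _] := Js.
have l0 : l%:R != 0 :> K by rewrite fieldExt_rat_natr_eq0 -lt0n prime_gt0.
apply: (stable_ideal_divides Js) => [||y Jy sy ty].
- by rewrite (@coprimeXr 2 _ 2) // coprimen2.
- by rewrite divff ?rpred1.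
have key (R : K) (k : nat) : R \in Z -> coprime l k -> R ^+ 2 = k%:R ->
    sg (R * y) = R * y -> tau (R * y) = R * y -> y / l%:R \in Z.
  move=> RZ lk R2 sR tR; have [z zE] := stable_ideal_int Js (JM _ _ RZ Jy) sR tR.
  apply: (@algint_coprime _ k l); first by rewrite coprime_sym.
    rewrite (_ : _ * _ = R * (R * y) / l%:R); last first.
      by rewrite [R * (R * _)]mulrA -expr2 R2 mulrA.
    by rewrite zE mulrCA mulrC mulKf // rpredM // rpred_int.
  by rewrite mulrCA divff // mulr1 JZ.
move: lmn; rewrite coprimeMr => /andP[lm ln].
case: sy ty => sy [] ty.
- by apply: (key 1 1%N); rewrite ?rpred1 ?coprimen1 ?expr1n ?mul1r.
- by apply: (key Q n) => //; rewrite ?QZ // rmorphM ?sgQ ?tauQ ?sy ?ty ?mulrNN.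
- by apply: (key P m) => //; rewrite ?PZ // rmorphM ?sgP ?tauP ?sy ?ty ?mulrNN.
- apply: (key (P * Q) (m * n)%N) => //; rewrite ?rpredM ?PZ ?QZ ?coprimeMr ?lm //.
  + by rewrite exprMn P2 Q2 natrM.
  + by rewrite !rmorphM /= sgP sgQ sy; ring.
  + by rewrite !rmorphM /= tauP tauQ ty; ring.
Qed.

Section AboveTwo.
Variables (J : K -> Prop) (e : int) (g : K).
Hypotheses (Js : stable_ideal_over 2 J) (gZ : g \in Z) (tg : tau g = g).
Hypotheses (e2 : e ^+ 2 = 1) (gN : g * sg g = 2 * e%:~R).

Let e1 : e%:~R ^+ 2 = 1 :> K. Proof. by rewrite -rmorphXn /= e2. Qed.
Let two0 : (2 : K) != 0. Proof. by rewrite fieldExt_rat_natr_eq0. Qed.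
Let g0 : g != 0.
Proof.
apply: contra_eq_neq gN => ->; rewrite mul0r eq_sym mulf_neq0 //.
by rewrite -sqrf_eq0 e1 oner_eq0.
Qed.

(** y / g is a root of a polynomial of degree 2 over the rationals. Its trace is
    (y sg g + sg y g) / (g sg g) and its norm is (y sg y) / (g sg g); both
    numerators are integers in J, hence even, while g sg g = 2 or -2. *)
Lemma two_divides_fixed y : J y -> tau y = y -> y / g \in Z.
Proof.
move=> Jy ty; have [JZ JD JM [Jsg Jtau] _] := Js.
have sgZ := algint_rmorph sg gZ.
have [t tE] : exists t : int, y * sg g + sg y * g = 2 * t%:~R.
  apply: (stable_ideal_int Js).
  - rewrite addrC mulrC [y * _]mulrC.
    by apply: JD; apply: JM => //; apply: Jsg.
  - by rewrite rmorphD !rmorphM /= !sgK; ring.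
  - by rewrite rmorphD !rmorphM /= -!sgtau ty tg.
have [u uE] : exists u : int, y * sg y = 2 * u%:~R.
  apply: (stable_ideal_int Js); first by apply: JM; [exact: JZ | exact: Jsg].
    by rewrite rmorphM /= sgK mulrC.
  by rewrite rmorphM /= -!sgtau ty.
apply: (@algint_quadratic _ _ (e * t)%:~R (e * u)%:~R); rewrite ?rpred_int //.
apply: (mulfI (mulf_neq0 two0 (mulf_neq0 g0 g0))); rewrite !intrM.
transitivity (2 * y ^+ 2); first by field.
transitivity (e%:~R * g * y * (2 * t%:~R) - e%:~R * g ^+ 2 * (2 * u%:~R)); last by field.
rewrite -tE -uE.
transitivity (e%:~R * y ^+ 2 * (g * sg g)); last by ring.
by rewrite gN; transitivity (2 * y ^+ 2 * e%:~R ^+ 2); [rewrite e1 mulr1 | ring].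
Qed.

(** With w = (1 + P Q) / 2, which is integral and satisfies w - tau w = P Q, write
    x = s + t w with s and t fixed by tau. Then (P Q)^2 t and (P Q)^2 s are fixed
    by tau and lie in J, so they are divisible by g. Hence g divides
    (P Q)^2 x = m n x; it also divides 2 x, and m n is odd. *)
Lemma two_divides x : (m * n = 1 %[mod 4])%N -> J x -> x / g \in Z.
Proof.
move=> mn1 Jx; have [JZ JD JM [Jsg Jtau] _] := Js.
have [k kE] : exists k, (m * n = 4 * k + 1)%N by exists ((m * n) %/ 4)%N; lia.
pose d := P * Q; have d2 : d ^+ 2 = 4 * k%:R + 1.
  by rewrite exprMn P2 Q2 -[LHS]natrM kE natrD natrM.
have td : tau d = - d by rewrite rmorphM /= tauP tauQ mulrN.
pose w := (1 + d) / 2.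
have wZ : w \in Z.
  apply: (@algint_quadratic _ _ 1 (- k%:R)); rewrite ?rpred1 ?rpredN ?rpred_nat //.
  apply: (mulfI (mulf_neq0 two0 two0)).
  transitivity (1 + 2 * d + d ^+ 2); first by rewrite /w; field.
  by rewrite d2 /w; field.
have tw : tau w = 1 - w by rewrite /w fmorph_div rmorphD rmorph1 td rmorph_nat; field.
have wd : 2 * w = 1 + d by rewrite /w; field.
have JN z : J z -> J (- z) by rewrite -mulN1r; apply: JM; rewrite rpredN1.
have dZ : d \in Z by rewrite rpredM ?PZ ?QZ.
(* y is d^2 t and v is d^2 s, for x = s + t w. *)
pose y := d * (x - tau x).
have Jy : J y by apply: JM => //; apply: JD => //; apply/JN/Jtau.
have ty : tau y = y by rewrite /y rmorphM rmorphB /= tauK td; ring.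
pose v := d ^+ 2 * x - w * y.
have Jv : J v by apply: JD; [apply: JM => //; rewrite rpredX | apply/JN/JM].
have tv : tau v = v.
  rewrite /v rmorphB rmorphM (rmorphM tau w) rmorphXn /= td tw ty sqrrN.
  apply/eqP; rewrite -subr_eq0; apply/eqP.
  transitivity ((2 * w - 1) * y - d ^+ 2 * (x - tau x)); first by ring.
  by rewrite wd /y; ring.
apply: (@algint_coprime _ (4 * k + 1)%N 2).
- by rewrite coprimen2 oddD oddM.
- have -> : (4 * k + 1)%:R * (x / g) = v / g + w * (y / g).
    by rewrite natrD natrM -d2 /v; field.
  by apply: rpredD; [|apply: rpredM => //]; apply: two_divides_fixed.
have -> : 2%:R * (x / g) = e%:~R * (sg g * x).
  apply: (mulfI g0); transitivity (2 * x); first by field.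
  transitivity (e%:~R * (g * sg g) * x); last by ring.
  by rewrite gN; transitivity (2 * e%:~R ^+ 2 * x); [rewrite e1 mulr1 | ring].
apply: rpredM; first exact: rpred_int.
by apply: rpredM; [exact: algint_rmorph | exact: JZ].
Qed.

End AboveTwo.

Definition biquadratic_aut (t : bool * bool) : {rmorphism K -> K} :=
  match t with
  | (false, false) => idfun | (true, false) => sg
  | (false, true) => tau | (true, true) => sg \o tau
  end.

(** For a maximal ideal M above l, the intersection of its conjugates is stable,
    and an integer z in it is a multiple of l as otherwise M would contain 1.
    Conversely a belongs to every conjugate of M, since a^2 is in l O. *)
Lemma ostrowski_principal (l f : nat) (a : K) :
    prime l -> a != 0 -> a ^+ 2 / l%:R \in Z ->
    (forall J x, stable_ideal_over l J -> J x -> x / a \in Z) ->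
  is_principal (@ostrowski_ideal K l f).
Proof.
move=> lp a0 al divJ.
have l0 : l%:R != 0 :> K by rewrite fieldExt_rat_natr_eq0 -lt0n prime_gt0.
have aZ : a \in Z by apply: algint_sqr; rewrite -(divfK l0 (a ^+ 2)) rpredM ?rpred_nat.
pose A := RingOfIntegers aZ; pose C := RingOfIntegers al.
have valnat k : roi_val (k%:R : ring_of_integers K) = k%:R by apply: (rmorph_nat val).
have A2 : A ^+ 2 = l%:R * C.
  by apply: val_inj; rewrite /= [RHS]/= valnat mulrCA divff // mulr1.
apply: (@prod_maximal_orbit _ _ (fun t => roi_map (biquadratic_aut t))
  (false, false) l f A) => //.
- by case=> [[] []] x; apply: val_inj; rewrite /= ?sgtau ?sgK ?tauK.
- by move=> x; apply: val_inj.
move=> M Mm Ml x; have [[M0 MD MM] _ _] := Mm.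
split=> [Mx|[b ->] t]; last first.
  rewrite rmorphM mulrC; apply: (MM).
  apply: (maximal_expn (n := 2) Mm); rewrite -rmorphXn A2 rmorphM rmorph_nat mulrC.
  exact: MM.
pose J y := exists z : ring_of_integers K,
  roi_val z = y /\ forall t, M (roi_map (biquadratic_aut t) z).
have Js : stable_ideal_over l J.
  split.
  - by move=> _ [z [<- _]]; apply: roi_valP.
  - move=> _ _ [z [<- Mz]] [z' [<- Mz']]; exists (z + z'); split=> // t.
    by rewrite rmorphD; exact: MD _ _ (Mz t) (Mz' t).
  - move=> c _ cZ [z [<- Mz]]; exists (RingOfIntegers cZ * z); split=> // t.
    by rewrite rmorphM; exact: MM _ _ (Mz t).
  - split=> _ [z [<- Mz]].
      exists (roi_map sg z); split=> // -[s t].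
      rewrite (_ : roi_map _ _ = roi_map (biquadratic_aut (~~ s, t)) z) //.
      by apply: val_inj; case: s t => [] [] /=; rewrite -?sgtau ?sgK.
    exists (roi_map tau z); split=> // -[s t].
    rewrite (_ : roi_map _ _ = roi_map (biquadratic_aut (s, ~~ t)) z) //.
    by apply: val_inj; case: s t => [] [] /=; rewrite ?tauK.
  move=> z [u [uE Mu]]; have {Mu}Mu := Mu (false, false).
  have uz : u = z%:~R.
    by apply: val_inj; rewrite /= uE; apply/esym/(rmorph_int val).
  have {}Mu : M (z%:~R).
    rewrite (_ : z%:~R = roi_map (biquadratic_aut (false, false)) u) // uz.
    exact: val_inj.
  apply/negPn/negP=> lz.
  have cop : gcdz l z = 1.
    by rewrite /gcdz; congr Posz; apply/eqP; move: lz; rewrite dvdzE -prime_coprime.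
  have [c [d cd]] := Bezoutz l z; rewrite cop in cd.
  apply: (maximal_proper Mm); rewrite (_ : 1 = c%:~R * l%:R + d%:~R * z%:~R).
    by apply: MD; apply: MM.
  by rewrite pmulrn -!intrM -intrD cd.
have xa : roi_val x / a \in Z by apply: (divJ J) => //; exists x.
by exists (RingOfIntegers xa); apply: val_inj; rewrite /= mulrCA divff ?mulr1.
Qed.

End StableIdeals.

(** * Elements that are a unit times a square *)

Section UnitSquareClasses.
Variable K : fieldExtType rat.
Local Notation Z := (algint (K := K)).

(** x is a unit times a square. For a = 0 both quotients would be 0, whence the
    first condition. *)
Definition unit_square (x : K) :=
  exists a : K, [/\ a != 0, a ^+ 2 / x \in Z & x / a ^+ 2 \in Z].

Lemma unit_square_sqr (a : K) : a != 0 -> unit_square (a ^+ 2).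
Proof. by move=> a0; exists a; rewrite divff ?rpred1 ?expf_neq0. Qed.

Lemma unit_squareM x y : unit_square x -> unit_square y -> unit_square (x * y).
Proof.
move=> [a [a0 ax xa]] [b [b0 bY yb]]; exists (a * b); rewrite mulf_neq0 //.
by split=> //; rewrite exprMn invfM mulrACA rpredM.
Qed.

Lemma unit_squareMr x y : x != 0 -> y != 0 ->
  unit_square x -> unit_square (x * y) -> unit_square y.
Proof.
move=> x0 y0 [a [a0 ax xa]] [b [b0 bxy xyb]]; exists (b / a).
rewrite mulf_neq0 ?invr_eq0 //.
have -> : (b / a) ^+ 2 / y = b ^+ 2 / (x * y) * (x / a ^+ 2).
  by field; rewrite x0 y0 a0.
have -> : y / (b / a) ^+ 2 = x * y / b ^+ 2 * (a ^+ 2 / x).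
  by field; rewrite x0 a0 b0.
by split=> //; apply: rpredM.
Qed.

(** With x = v b^2 and y = a b D, the square of u a + b D is u c times
    1 + t (x + y), where t = 2 / c is an integer, and this factor is a unit with
    inverse 1 + t (x - y). *)
Lemma descent_unit_square (u v a b c t : nat) (D : K) :
    D ^+ 2 = (u * v)%:R -> (0 < u)%N -> (c * t = 2)%N ->
    (u * a ^ 2 = v * b ^ 2 + c)%N -> unit_square (u * c)%:R.
Proof.
move=> D2 u0 ct uv.
have c0 : (0 < c)%N by case: c ct {uv}.
have DZ : D \in Z by apply: algint_sqr; rewrite D2 rpred_nat.
pose x : K := v%:R * b%:R ^+ 2; pose y : K := a%:R * b%:R * D.
have xZ : x \in Z by rewrite rpredM ?rpredX ?rpred_nat.
have yZ : y \in Z by rewrite !rpredM ?rpred_nat.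
have ctK : c%:R * t%:R = 2 :> K by rewrite -natrM ct.
have uvK : u%:R * a%:R ^+ 2 = x + c%:R :> K by rewrite /x -!natrX -!natrM -natrD uv.
have y2 : y ^+ 2 = (x + c%:R) * x.
  by rewrite /y exprMn D2 -uvK natrM /x; ring.
have cK : c%:R != 0 :> K by rewrite fieldExt_rat_natr_eq0 -lt0n.
have uK : u%:R != 0 :> K by rewrite fieldExt_rat_natr_eq0 -lt0n.
have tK : t%:R = 2 / c%:R :> K by rewrite -ctK mulrC mulKf.
have unit : (1 + t%:R * (x + y)) * (1 + t%:R * (x - y)) = 1.
  transitivity (1 + 2 * t%:R * x + t%:R ^+ 2 * (x ^+ 2 - y ^+ 2)); first by ring.
  by rewrite y2 tK; field.
have aE : (u%:R * a%:R + b%:R * D) ^+ 2 = (u * c)%:R * (1 + t%:R * (x + y)).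
  transitivity (u%:R * (u%:R * a%:R ^+ 2) + 2 * u%:R * (a%:R * b%:R * D)
    + b%:R ^+ 2 * D ^+ 2).
    by ring.
  by rewrite uvK D2 !natrM tK -/y /x; field.
have ucK : (u * c)%:R != 0 :> K by rewrite natrM mulf_neq0.
exists (u%:R * a%:R + b%:R * D); rewrite -sqrf_eq0 aE; split.
- rewrite mulf_neq0 //; apply/eqP=> e; move: unit; rewrite e mul0r => /eqP.
  by rewrite eq_sym oner_eq0.
- by rewrite mulrC mulKf // rpredD ?rpred1 // rpredM ?rpred_nat // rpredD.
rewrite invfM mulrA divff // mul1r (_ : _^-1 = 1 + t%:R * (x - y)).
  by rewrite rpredD ?rpred1 // rpredM ?rpred_nat // rpredB.
by apply: (mulfI (_ : 1 + t%:R * (x + y) != 0)); rewrite ?unit ?divff //;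
  apply: contra_eq_neq unit => ->; rewrite mul0r eq_sym oner_eq0.
Qed.

Lemma unit_square_sqr_nat (x k : nat) : (0 < k)%N -> (0 < x)%N ->
  unit_square ((x * k ^ 2)%N%:R : K) -> unit_square (x%:R : K).
Proof.
move=> k0 x0; rewrite mulnC natrM natrX.
have kK : k%:R != 0 :> K by rewrite fieldExt_rat_natr_eq0 -lt0n.
apply: unit_squareMr; last exact: unit_square_sqr.
  by rewrite expf_neq0.
by rewrite fieldExt_rat_natr_eq0 -lt0n.
Qed.

(** Only the parities of the exponents matter, so the classes form a vector space
    over the field with two elements. *)
Lemma unit_square_addb (q r s : nat) (b1 b2 b3 c1 c2 c3 : bool) :
    (0 < q)%N -> (0 < r)%N -> (0 < s)%N ->
  unit_square ((q ^ b1 * r ^ b2 * s ^ b3)%N%:R : K) ->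
  unit_square ((q ^ c1 * r ^ c2 * s ^ c3)%N%:R : K) ->
  unit_square
    ((q ^ (b1 (+) c1) * r ^ (b2 (+) c2) * s ^ (b3 (+) c3))%N%:R : K).
Proof.
move=> q0 r0 s0 B C; have := unit_squareM B C; rewrite -natrM.
have xor k (b c : bool) :
    (k ^ b * k ^ c = k ^ (b (+) c) * (k ^ (b && c)) ^ 2)%N.
  by case: b; case: c; rewrite ?expn0 ?expn1 ?exp1n ?muln1 ?mul1n ?mulnn.
have -> : (q ^ b1 * r ^ b2 * s ^ b3 * (q ^ c1 * r ^ c2 * s ^ c3)
    = q ^ (b1 (+) c1) * r ^ (b2 (+) c2) * s ^ (b3 (+) c3)
      * (q ^ (b1 && c1) * r ^ (b2 && c2) * s ^ (b3 && c3)) ^ 2)%N.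
  rewrite !expnMn mulnACA [(q ^ b1 * _ * _)%N]mulnACA !xor.
  by rewrite [RHS]mulnACA [X in _ = (X * _)%N]mulnACA.
by apply: unit_square_sqr_nat; rewrite !muln_gt0 !expn_gt0 ?q0 ?r0 ?s0.
Qed.

End UnitSquareClasses.

(** * The ramified primes of the field *)

(** Here pr, ps, qr, qs, rs are the symbols of p and q at r and at s and the symbol
    of r at s; tr and ts are the symbols of 2. The bits bq, br, bs are the
    exponents of q, r, s in the factor u of q r s, with c = 2^c2; the bits bp',
    bq', br', bs' are those in the factor u of p q r s, with c = 1. The four
    equations are the relations modulo r and s, the two inequalities exclude the
    trivial factorizations. Modulo the class of q r s the vectors of the exponents
    become (bq + br, bq + bs) and (bq' + br', bq' + bs'), and the conclusion is that
    their determinant is nonzero. *)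
Lemma independent_classes (pr ps qr qs rs tr ts : bool)
    (bq br bs c2 bp' bq' br' bs' : bool) :
  [|| [&& tr, ts, qr, qs & pr (+) ps],
      [&& tr, ts, qr (+) qs, pr & ps],
      [&& ~~ tr, ts, rs, qs, pr & ~~ qr],
      [&& ~~ tr, ts, qr, rs, pr & ~~ ps]
    | [&& ~~ tr, ts, qr, pr, ps (+) qs & ~~ rs]] ->
  (if br then (qr && ~~ bq) (+) (rs && ~~ bs)
   else (qr && bq) (+) (rs && bs)) = tr && c2 ->
  (if bs then (qs && ~~ bq) (+) (rs && ~~ br)
   else (qs && bq) (+) (rs && br)) = ts && c2 ->
  (if br' then (pr && ~~ bp') (+) (qr && ~~ bq') (+) (rs && ~~ bs')
   else (pr && bp') (+) (qr && bq') (+) (rs && bs')) = false ->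
  (if bs' then (ps && ~~ bp') (+) (qs && ~~ bq') (+) (rs && ~~ br')
   else (ps && bp') (+) (qs && bq') (+) (rs && br')) = false ->
  c2 || ~~ ((bq == br) && (br == bs)) ->
  ~~ [&& bp' == bq', bq' == br' & br' == bs'] ->
  ((bq (+) br) && (bq' (+) bs')) (+) ((bq (+) bs) && (bq' (+) br')).
Proof.
case: pr; case: ps; case: qr; case: qs; case: rs; case: tr; case: ts => //= _;
  by case: bq; case: br; case: bs; case: c2 => //=;
  case: bp'; case: bq'; case: br'; case: bs'.
Qed.

Section PolyaBiquadratic.
Variables (K : fieldExtType rat) (p q r s : nat) (P Q : K).
Hypotheses (p_prime : prime p) (q_prime : prime q).
Hypotheses (r_prime : prime r) (s_prime : prime s).
Hypothesis distinct : uniq [:: p; q; r; s].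
Hypotheses (p4 : p = 3 %[mod 4]) (q4 : q = 3 %[mod 4]).
Hypotheses (r4 : r = 1 %[mod 4]) (s4 : s = 1 %[mod 4]).
Hypotheses (P2 : P ^+ 2 = p%:R) (Q2 : Q ^+ 2 = (q * r * s)%:R).
Hypothesis genK : <<1 & [:: P; Q]>>%VS = fullv.
Local Notation Z := (algint (K := K)).

Let odd_p : odd p. Proof. by clear -p4; lia. Qed.
Let odd_q : odd q. Proof. by clear -q4; lia. Qed.
Let odd_r : odd r. Proof. by clear -r4; lia. Qed.
Let odd_s : odd s. Proof. by clear -s4; lia. Qed.

Let ndvd l k : prime l -> prime k -> l != k -> ~~ (l %| k)%N.
Proof. by move=> lp kp lk; rewrite dvdn_prime2. Qed.

Let neqs : [/\ [/\ p != q, p != r & p != s], q != r, q != s & r != s].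
Proof.
move: distinct; rewrite /= !inE !negb_or.
by move=> /andP[/and3P[pq pr ps] /andP[/andP[qr qs] /andP[rs _]]]; split.
Qed.

Let p_gt0 := prime_gt0 p_prime.
Let q_gt0 := prime_gt0 q_prime.
Let r_gt0 := prime_gt0 r_prime.
Let s_gt0 := prime_gt0 s_prime.

Let sqf_qrs : squarefree (q * r * s).
Proof.
have [_ qr qs rs] := neqs; rewrite -mulnA; apply: squarefreeM => //.
  by rewrite Euclid_dvdM // negb_or !ndvd.
by apply: squarefreeM; rewrite ?ndvd //; apply: squarefree_prime.
Qed.

Let sqf_pqrs : squarefree (p * (q * r * s)).
Proof.
have [[pq pr ps] _ _ _] := neqs; apply: squarefreeM => //.
by rewrite !Euclid_dvdM // !negb_or !ndvd.
Qed.

Let qrs_gt1 : (1 < q * r * s)%N.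
Proof.
rewrite -mulnA (leq_trans (prime_gt1 q_prime)) //.
by rewrite leq_pmulr // muln_gt0 r_gt0.
Qed.

Let pqrs_gt1 : (1 < p * (q * r * s))%N.
Proof. by rewrite (leq_trans qrs_gt1) // leq_pmull. Qed.

Let pqrs4 : p * (q * r * s) = 1 %[mod 4].
Proof. by rewrite -modnMm -(modnMm (q * r)) -(modnMm q) p4 q4 r4 s4. Qed.

Let Knat0 (k : nat) : (0 < k)%N -> k%:R != 0 :> K.
Proof. by rewrite fieldExt_rat_natr_eq0 -lt0n. Qed.

Lemma unit_square_P : unit_square (P ^+ 2).
Proof. by apply: unit_square_sqr; rewrite -sqrf_eq0 P2 Knat0. Qed.

(** The descent for D = p has only trivial factorizations, so c = 2 in it. *)
Lemma norm_pm2 : exists (x y : nat) (e : int),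
  e ^+ 2 = 1 /\ x%:R ^+ 2 = p%:R * y%:R ^+ 2 + 2 * e%:~R :> K.
Proof.
have nm1 b : ~~ (p %| b ^ 2 + 1)%N by apply: neg1_nonsquare.
have [u [v [a [b [c [uv abc H]]]]]] :=
  pell_descent (prime_gt1 p_prime) odd_p (squarefree_prime p_prime) nm1.
have [[] [uE vE]] := prime_split p_prime uv; subst u v;
  rewrite expn0 expn1 mul1n in abc.
  case: H => [[_ _ /eqP//]|[c2 _]]; subst c.
  exists b, a, (-1); split=> //; rewrite -!natrX -natrM abc natrD rmorphN1; ring.
case: H => [[_ /eqP//]|[c2 _]]; subst c.
by exists a, b, 1; rewrite -!natrX abc natrD natrM mulr1.
Qed.

(** As g^2 / 2 has the inverse obtained by changing the sign of P, the element g
    also shows that 2 is a unit times a square. *)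
Lemma exists_norm_pm2 (sg tau : {rmorphism K -> K}) : sg P = - P -> tau P = P ->
  exists (g : K) (e : int),
    [/\ g \in Z, tau g = g, e ^+ 2 = 1 & g * sg g = 2 * e%:~R] /\
    [/\ g != 0, g ^+ 2 / 2 \in Z & 2 / g ^+ 2 \in Z].
Proof.
move=> sP tP; have [x [y [e [e2 xy]]]] := norm_pm2.
have PZ : P \in Z by apply: (PZ P2).
have e1 : e%:~R ^+ 2 = 1 :> K by rewrite -rmorphXn /= e2.
have K2 : (2 : K) != 0 by apply: Knat0.
pose g : K := x%:R + y%:R * P; exists g, e.
have gN : g * sg g = 2 * e%:~R.
  rewrite /g rmorphD rmorphM /= !rmorph_nat sP.
  transitivity (x%:R ^+ 2 - y%:R ^+ 2 * P ^+ 2); first by ring.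
  by rewrite xy P2; ring.
have gE : g ^+ 2 = 2 * (p%:R * y%:R ^+ 2 + e%:~R + x%:R * y%:R * P).
  transitivity (x%:R ^+ 2 + y%:R ^+ 2 * P ^+ 2 + 2 * x%:R * y%:R * P).
    by rewrite /g; ring.
  by rewrite xy P2; ring.
have u1 : (p%:R * y%:R ^+ 2 + e%:~R + x%:R * y%:R * P)
    * (p%:R * y%:R ^+ 2 + e%:~R - x%:R * y%:R * P) = 1.
  transitivity ((p%:R * y%:R ^+ 2 + e%:~R) ^+ 2
    - x%:R ^+ 2 * y%:R ^+ 2 * P ^+ 2); first by ring.
  by rewrite xy P2 -[RHS]e1; ring.
have g0 : g != 0.
  apply: contra_eq_neq gN => ->; rewrite mul0r eq_sym mulf_neq0 //.
  by rewrite -sqrf_eq0 e1 oner_eq0.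
have uZ : x%:R * y%:R * P \in Z by rewrite !rpredM ?rpred_nat.
have vZ : p%:R * y%:R ^+ 2 + e%:~R \in Z.
  by rewrite rpredD ?rpred_int // rpredM ?rpredX ?rpred_nat.
split; split=> //.
- by rewrite rpredD ?rpred_nat // rpredM ?rpred_nat.
- by rewrite /g rmorphD rmorphM /= !rmorph_nat tP.
- by rewrite gE mulrC mulKf // rpredD.
rewrite gE invfM mulrA divff // mul1r.
rewrite (_ : _^-1 = p%:R * y%:R ^+ 2 + e%:~R - x%:R * y%:R * P) ?rpredB //.
have A0 : p%:R * y%:R ^+ 2 + e%:~R + x%:R * y%:R * P != 0.
  by apply: contra_eq_neq u1 => ->; rewrite mul0r eq_sym oner_eq0.
by apply: (mulfI A0); rewrite u1 divff.
Qed.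

(** -1 is not a square modulo q r s because it is not one modulo q. *)
Lemma descent_qrs : exists bq br bs c2 : bool,
  [/\ unit_square ((q ^ bq * r ^ br * s ^ bs * 2 ^ c2)%N%:R : K),
      (if br then (nonresidue r q && ~~ bq) (+) (nonresidue r s && ~~ bs)
       else (nonresidue r q && bq) (+) (nonresidue r s && bs)) = nonresidue r 2 && c2,
      (if bs then (nonresidue s q && ~~ bq) (+) (nonresidue s r && ~~ br)
       else (nonresidue s q && bq) (+) (nonresidue s r && br)) = nonresidue s 2 && c2
    & c2 || ~~ ((bq == br) && (br == bs))].
Proof.
have [_ qr qs rs] := neqs.
have nm1 b : ~~ (q * r * s %| b ^ 2 + 1)%N.
  apply: contra (neg1_nonsquare b q_prime q4); apply: dvdn_trans.
  by rewrite -mulnA dvdn_mulr.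
have odd_d : odd (q * r * s) by rewrite !oddM odd_q odd_r.
have [u [v [a [b [c [uv abc H]]]]]] := pell_descent qrs_gt1 odd_d sqf_qrs nm1.
have [bq [br [bs [uE vE]]]] := prime3_split q_prime r_prime s_prime uv.
have [c2 cE c2P] : exists2 c2 : bool,
    c = (2 ^ c2)%N & c2 || ~~ ((bq == br) && (br == bs)).
  case: H => [[c1 u1 v1]|[c2 _]]; last by exists true.
  exists false => //=; apply/negP=> /andP[/eqP e1 /eqP e2].
  by move: u1 v1; rewrite uE vE e1 e2; case: (bs).
have nd21 l : prime l -> odd l -> ~~ (l %| 2)%N.
  by move=> lp lo; rewrite ndvd //; apply: contraTneq lo => ->.
have nd2 l : prime l -> odd l -> ~~ (l %| 2 ^ c2)%N.
  by move=> lp lo; rewrite Euclid_dvdX // negb_and nd21.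
exists bq, br, bs, c2; split=> //.
- rewrite -uE -cE; apply: (@descent_unit_square K u v a b c (2 ^ (~~ c2)) Q) => //.
  + by rewrite uv.
  + by rewrite uE !muln_gt0 !expn_gt0 q_gt0 r_gt0 s_gt0.
  + by rewrite cE; case: (c2).
- rewrite -[RHS](nonresidueX r 2 c2) -[RHS](@nonresidue_descent r _ _ br
    (q ^ bq * s ^ bs) (q ^ (~~ bq) * s ^ (~~ bs)) a b) ?nd2 //.
    by case: (br); rewrite nonresidueXM ?ndvd // eq_sym.
  by rewrite !(mulnCA (r ^ _)%N (q ^ _)%N) !(mulnA (q ^ _)%N) -uE -vE -cE.
rewrite -[RHS](nonresidueX s 2 c2) -[RHS](@nonresidue_descent s _ _ bs
  (q ^ bq * r ^ br) (q ^ (~~ bq) * r ^ (~~ br)) a b) ?nd2 //.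
  by case: (bs); rewrite nonresidueXM ?ndvd // eq_sym.
by rewrite !(mulnC (s ^ _)%N) -uE -vE -cE.
Qed.


(** Here c = 1, as p q r s = 1 modulo 4. The factor p of u is dropped, since p is
    a square in K. *)
Lemma descent_pqrs : exists bp bq br bs : bool,
  [/\ unit_square ((q ^ bq * r ^ br * s ^ bs)%N%:R : K),
      (if br then (nonresidue r p && ~~ bp) (+) (nonresidue r q && ~~ bq)
         (+) (nonresidue r s && ~~ bs)
       else (nonresidue r p && bp) (+) (nonresidue r q && bq)
         (+) (nonresidue r s && bs)) = false,
      (if bs then (nonresidue s p && ~~ bp) (+) (nonresidue s q && ~~ bq)
         (+) (nonresidue s r && ~~ br)
       else (nonresidue s p && bp) (+) (nonresidue s q && bq)
         (+) (nonresidue s r && br)) = false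
    & ~~ [&& bp == bq, bq == br & br == bs]].
Proof.
have [[pq pr ps] qr qs rs] := neqs.
have nm1 b : ~~ (p * (q * r * s) %| b ^ 2 + 1)%N.
  apply: contra (neg1_nonsquare b p_prime p4); apply: dvdn_trans.
  by rewrite dvdn_mulr.
have odd_d : odd (p * (q * r * s)) by rewrite !oddM odd_p odd_q odd_r.
have [u [v [a [b [c [uv abc H]]]]]] := pell_descent pqrs_gt1 odd_d sqf_pqrs nm1.
case: H => [[c1 u1 v1]|[_]]; last by rewrite pqrs4.
have [bp [u' [v' [uE vE uv']]]] := prime_mul_split p_prime uv.
have [bq [br [bs [uE' vE']]]] := prime3_split q_prime r_prime s_prime uv'.
rewrite uE' !mulnA in uE; rewrite vE' !mulnA in vE.
have nd1 l : prime l -> ~~ (l %| 1)%N by move=> lp; rewrite dvdn1 gtn_eqF ?prime_gt1.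
have ndX l k (e : bool) : prime l -> prime k -> l != k -> ~~ (l %| k ^ e)%N.
  by move=> lp kp lk; rewrite Euclid_dvdX // negb_and ndvd.
have n1 l : nonresidue l 1 = false by rewrite -[1%N](expn0 1) (nonresidueX l 1 false) andbF.
have nXM l k m1 m2 (e e1 e2 : bool) :
    prime l -> odd l -> prime k -> prime m1 -> prime m2 ->
    l != k -> l != m1 -> l != m2 ->
  nonresidue l (k ^ e * (m1 ^ e1 * m2 ^ e2)) =
    (nonresidue l k && e) (+) (nonresidue l m1 && e1) (+) (nonresidue l m2 && e2).
  move=> lp lo kp m1p m2p lk lm1 lm2; rewrite nonresidueM ?ndX //; last first.
    by rewrite Euclid_dvdM // negb_or !ndX.
  by rewrite nonresidueXM ?ndvd // nonresidueX addbA.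
exists bp, bq, br, bs; split.
- have uc : unit_square ((u * c)%N%:R : K).
    apply: (@descent_unit_square K u v a b c 2 (P * Q)); rewrite ?c1 //.
    + by rewrite exprMn P2 Q2 uv -natrM.
    + by rewrite uE !muln_gt0 !expn_gt0 p_gt0 q_gt0 r_gt0 s_gt0.
    + by rewrite abc c1.
  move: uc; rewrite c1 muln1 uE -!mulnA natrM; case: (bp); last by rewrite mul1r.
  apply: unit_squareMr; rewrite ?Knat0 ?expn1 // -?P2 ?muln_gt0 ?expn_gt0;
    rewrite ?q_gt0 ?r_gt0 ?s_gt0 //.
  exact: unit_square_P.
- rewrite -[RHS](n1 r) -[RHS](@nonresidue_descent r _ _ br (p ^ bp * (q ^ bq * s ^ bs))
    (p ^ (~~ bp) * (q ^ (~~ bq) * s ^ (~~ bs))) a b) ?nd1 //.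
    by case: (br); rewrite nXM // eq_sym.
  rewrite !(mulnCA (r ^ _)%N (p ^ _)%N) !(mulnCA (r ^ _)%N (q ^ _)%N).
  by rewrite !(mulnA (q ^ _)%N) !(mulnA (p ^ _)%N) -uE -vE abc c1.
- rewrite -[RHS](n1 s) -[RHS](@nonresidue_descent s _ _ bs (p ^ bp * (q ^ bq * r ^ br))
    (p ^ (~~ bp) * (q ^ (~~ bq) * r ^ (~~ br))) a b) ?nd1 //.
    by case: (bs); rewrite nXM // eq_sym.
  by rewrite !(mulnC (s ^ _)%N) !(mulnA (p ^ _)%N) -uE -vE abc c1.
apply/negP=> /and3P[/eqP e1 /eqP e2 /eqP e3].
by move: u1 v1; rewrite uE vE e1 e2 e3; case: (bs).
Qed.

(** The five sets of conditions, with all symbols taken modulo r and s. *)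
Hypothesis symbols :
  let pr := nonresidue r p in let ps := nonresidue s p in
  let qr := nonresidue r q in let qs := nonresidue s q in
  let rs := nonresidue s r in let tr := nonresidue r 2 in let ts := nonresidue s 2 in
  [|| [&& tr, ts, qr, qs & pr (+) ps],
      [&& tr, ts, qr (+) qs, pr & ps],
      [&& ~~ tr, ts, rs, qs, pr & ~~ qr],
      [&& ~~ tr, ts, qr, rs, pr & ~~ ps]
    | [&& ~~ tr, ts, qr, pr, ps (+) qs & ~~ rs]].

(** Adding the class of q r s if necessary, one makes the exponent of q vanish in
    both classes; two independent vectors, together with their sum, are all the
    nonzero vectors of the plane. *)
Lemma unit_square_ramified : unit_square (2 : K) ->
  [/\ unit_square (q%:R : K), unit_square (r%:R : K) & unit_square (s%:R : K)].
Proof.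
move=> us2; have [_ qr qs rs] := neqs.
have [bq [br [bs [c2 [Vd Er Es nt]]]]] := descent_qrs.
have [bp' [bq' [br' [bs' [Vd' Er' Es' nt']]]]] := descent_pqrs.
pose V (b1 b2 b3 : bool) := unit_square ((q ^ b1 * r ^ b2 * s ^ b3)%N%:R : K).
have VD b1 b2 b3 e1 e2 e3 : V b1 b2 b3 -> V e1 e2 e3 ->
    V (b1 (+) e1) (b2 (+) e2) (b3 (+) e3).
  exact: unit_square_addb.
have {Vd} V1 : V bq br bs.
  move: Vd; rewrite natrM mulrC; case: (c2); last by rewrite mul1r.
  apply: unit_squareMr; rewrite ?Knat0 // ?expn1 //.
  by rewrite !muln_gt0 !expn_gt0 q_gt0 r_gt0 s_gt0.
have V3 : V true true true.
  rewrite /V !expn1 -Q2; apply: unit_square_sqr.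
  by rewrite -sqrf_eq0 Q2 Knat0 // !muln_gt0 q_gt0 r_gt0.
have rsE : nonresidue r s = nonresidue s r by apply: nonresidue_sym.
rewrite rsE in Er Er'.
have ind := independent_classes symbols Er Es Er' Es' nt nt'.
have W b1 b2 b3 : V b1 b2 b3 -> V false (b1 (+) b2) (b1 (+) b3).
  by case: b1 => // Vb; have := VD _ _ _ _ _ _ Vb V3; rewrite !(addbC _ true).
have {V1} W1 := W _ _ _ V1; have {Vd'} W2 := W _ _ _ Vd'.
have W3 := VD _ _ _ _ _ _ W1 W2.
have [Vr Vs] : V false true false /\ V false false true.
  by move: W1 W2 W3 ind; do 4![case: (_ (+) _) => //=].
have Vq := VD _ _ _ _ _ _ V3 (VD _ _ _ _ _ _ Vr Vs).
by move: Vq Vr Vs; rewrite /V /= !expn1 !expn0 ?muln1 ?mul1n.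
Qed.

Lemma polya_biquadratic : polya_field K.
Proof.
have p_gt1 := prime_gt1 p_prime.
have [sg [tau [[sgK tauK sgtau] [sgP sgQ tauP tauQ fixed]]]] :=
  biquadratic_conj P2 Q2 genK
    (fun k => squarefree_rat_nonsquare k p_gt1 (squarefree_prime p_prime))
    (fun k => squarefree_rat_nonsquare k qrs_gt1 sqf_qrs)
    (fun k => squarefree_rat_nonsquare k pqrs_gt1 sqf_pqrs).
have [g [e [[gZ tg e2 gN] [g0 g2 g2']]]] := exists_norm_pm2 sgP tauP.
have us2 : unit_square (2 : K) by exists g.
have [usq usr uss] := unit_square_ramified us2.
have usp : unit_square (p%:R : K) by rewrite -P2; apply: unit_square_P.
move=> l f lp _.
have [l2|l2] := eqVneq l 2%N.
  subst l; apply: (@ostrowski_principal _ _ _ sgK tauK sgtau 2 f g) => // J x Js.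
  exact: (two_divides P2 Q2 sgK tauK sgtau tauP tauQ fixed Js gZ tg e2 gN).
have lo : odd l by case: (even_prime lp) => // l2'; rewrite l2' in l2.
have ram : unit_square (l%:R : K) -> is_principal (@ostrowski_ideal K l f).
  move=> [a [a0 al la]].
  apply: (@ostrowski_principal _ _ _ sgK tauK sgtau l f a) => // J x Js.
  by apply: (ramified_divides sgK tauK sgtau fixed lp lo al la Js).
have [lp'|lp'] := eqVneq l p; first by apply: ram; rewrite lp'.
have [lq'|lq'] := eqVneq l q; first by apply: ram; rewrite lq'.
have [lr'|lr'] := eqVneq l r; first by apply: ram; rewrite lr'.
have [ls'|ls'] := eqVneq l s; first by apply: ram; rewrite ls'.
apply: (@ostrowski_principal _ _ _ sgK tauK sgtau l f l%:R) => //.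
- by rewrite Knat0 ?prime_gt0.
- by rewrite expr2 mulfK ?Knat0 ?prime_gt0 // rpred_nat.
move=> J x Js.
apply: (unramified_divides P2 Q2 sgK tauK sgtau sgP sgQ tauP tauQ fixed) => //.
by rewrite !coprimeMr !prime_coprime // !ndvd.
Qed.

End PolyaBiquadratic.

Theorem theorem2 (p q r s : nat)
    (p_prime : prime p) (q_prime : prime q) (r_prime : prime r) (s_prime : prime s)
    (pqrs_distinct : uniq [:: p; q; r; s])
    (p_mod4 : p = 3 %[mod 4]) (q_mod4 : q = 3 %[mod 4])
    (r_mod4 : r = 1 %[mod 4]) (s_mod4 : s = 1 %[mod 4]) :
  (* case (i) *)
  ([/\ legendre 2%:Z r = -1, legendre 2%:Z s = -1 &
     (* C1 *)
     [/\ legendre q%:Z r = -1, legendre q%:Z s = -1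
       & legendre (r * s)%N%:Z p = -1] \/
     (* C2 *)
     [/\ legendre (r * s)%N%:Z q = -1, legendre r%:Z p = -1
       & legendre s%:Z p = -1]] \/
  (* case (ii) *)
   [/\ legendre 2%:Z r = 1, legendre 2%:Z s = -1 &
     [\/ (* C3 *)
       [/\ legendre r%:Z s = -1, legendre q%:Z s = -1,
           legendre r%:Z p = -1 & legendre r%:Z q = 1],
       (* C4 *)
       [/\ legendre r%:Z q = -1, legendre r%:Z s = -1,
           legendre r%:Z p = -1 & legendre s%:Z p = 1]
     | (* C5 *)
       [/\ legendre r%:Z q = -1, legendre r%:Z p = -1,
           legendre (p * q)%N%:Z s = -1 & legendre r%:Z s = 1]]]) ->
  polya_field (Qadjoin [:: sqrtC p%:R; sqrtC (q * r * s)%N%:R]).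
Proof.
move=> H; rewrite /Qadjoin.
case: (num_field_exists _) => K /= [j [[|P [|Q []]] // [jP jQ] genK]].
have P2 : P ^+ 2 = p%:R.
  by apply: (fmorph_inj j); rewrite rmorphXn rmorph_nat /= jP sqrtCK.
have Q2 : Q ^+ 2 = (q * r * s)%:R.
  by apply: (fmorph_inj j); rewrite rmorphXn rmorph_nat /= jQ sqrtCK.
apply: (@polya_biquadratic K p q r s P Q) => //=.
have odd4 k : k = 3 %[mod 4] \/ k = 1 %[mod 4] -> odd k by clear; lia.
have [odd_p odd_q odd_r odd_s] : [/\ odd p, odd q, odd r & odd s].
  by split; apply: odd4; auto.
have N1 l k : legendre k%:Z l = -1 -> nonresidue l k by move=> e; rewrite /nonresidue e.
have P1 l k : legendre k%:Z l = 1 -> nonresidue l k = false.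
  by move=> e; rewrite /nonresidue e.
move: pqrs_distinct; rewrite /= !inE !negb_or.
move=> /andP[/and3P[pq pr ps] /andP[/andP[qr qs] /andP[rs _]]].
have sym l k : prime l -> prime k -> odd k -> l != k -> l = 1 %[mod 4] ->
  nonresidue k l = nonresidue l k.
  by move=> lp kp ko lk l4; rewrite (nonresidue_sym lp kp).
have rpE : nonresidue p r = nonresidue r p by apply: sym; rewrite // eq_sym.
have spE : nonresidue p s = nonresidue s p by apply: sym; rewrite // eq_sym.
have rqE : nonresidue q r = nonresidue r q by apply: sym; rewrite // eq_sym.
have sqE : nonresidue q s = nonresidue s q by apply: sym; rewrite // eq_sym.
have nd l k : prime l -> prime k -> l != k -> ~~ (l %| k)%N.
  by move=> lp kp; rewrite dvdn_prime2.
case: H => [[/N1 -> /N1 -> [[/N1 -> /N1 -> /N1]|[/N1 + /N1 + /N1]]]|[/P1 -> /N1 -> H]].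
- by rewrite nonresidueM ?nd // rpE spE => ->.
- by rewrite nonresidueM ?nd // rpE spE rqE sqE => -> -> ->; rewrite !orbT.
case: H => [[/N1 -> /N1 -> /N1 + /P1]|[/N1 + /N1 -> /N1 + /P1]
  |[/N1 + /N1 + /N1 + /P1 ->]].
- by rewrite rpE rqE => -> ->; rewrite !orbT.
- by rewrite rpE spE rqE => -> -> ->; rewrite !orbT.
by rewrite nonresidueM ?nd 1?eq_sym // rpE rqE => -> -> ->; rewrite !orbT.
Qed.
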